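(* There is an algorithm which, given a simple LQCA $A=(\Sigma,q,N,\delta)$ with $|N|=r$, decides whether the columns $U_A(\cdot,c)$, $c\in\mathcal C_A$, of its time evolution operator are pairwise orthogonal, in time $O(n^2)$ in the algebraic model of computation, where $n=|\Sigma|^{r+1}$.
   Context: A linear quantum cellular automaton (LQCA) is a tuple $A=(\Sigma,q,N,\delta)$ where $\Sigma$ is a finite nonempty set of states, $N=(a_1,\dots,a_r)$ is a strictly increasing sequence of integers, $\delta:\Sigma^r\to\mathbb C^\Sigma$ satisfies $\|\delta(w)\|>0$ for all $w$, and $q\in\Sigma$ satisfies $[\delta(q,\dots,q)](x)=1$ if $x=q$ and $0$ otherwise. It is simple if $a_r-a_1=r-1$. The input is the table of $\delta$. In the algebraic model, complex numbers occupy unit space and arithmetic operations and comparisons take unit time. A configuration is a map $c:\mathbb Z\to\Sigma$ with $c_i\ne q$ for only finitely many $i$; $\mathcal C_A$ is the set of configurations. With $c_{i+N}=(c_{i+a_1},\dots,c_{i+a_r})$, $U_A(d,c)=\prod_{i\in\mathbb Z}[\delta(c_{i+N})](d_i)$; $U_A(\cdot,c)$ is the column $d\mapsto U_A(d,c)$ in $\ell_2(\mathcal C_A)$ with inner product $\langle u,v\rangle=\sum_d u(d)\overline{v(d)}$. *)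

(* Defs.v *)
(* (+ mathcomp-classical fsbigop, complex numbers over Stdlib's R). *)
From mathcomp Require Import all_boot all_order all_algebra.
From mathcomp Require Import boolp classical_sets functions cardinality fsbigop.
From mathcomp Require Import Rstruct.
From mathcomp Require Import complex.
Set Implicit Arguments. Unset Strict Implicit. Unset Printing Implicit Defensive.
Import Order.TTheory GRing.Theory Num.Theory.
Local Open Scope ring_scope.
Local Open Scope classical_set_scope.

(** Complex numbers. *)
Definition CC := complex Rdefinitions.R.

(** * Linear quantum cellular automata *)

(* Raw data of an LQCA (Sigma, q, N, delta) with |N| = r, Sigma a finite type. *)
Record lqca (S : finType) := LQCA {
  lq_q : S;
  lq_r : nat;
  lq_N : lq_r.-tuple int;                 (* N = (a_1, ..., a_r) *)
  lq_delta : lq_r.-tuple S -> S -> CC      (* delta : Sigma^r -> C^Sigma *)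
}.
Arguments LQCA {S}.
Arguments lq_delta {S} _ _ _.

Definition qword (S : finType) (A : lqca S) : (lq_r A).-tuple S :=
  [tuple lq_q A | _ < lq_r A].

(* The defining conditions of an LQCA. *)
Definition is_lqca (S : finType) (A : lqca S) : Prop :=
  (forall i j : 'I_(lq_r A), (i < j)%N -> tnth (lq_N A) i < tnth (lq_N A) j)
  /\ (forall w, 0 < \sum_(x : S) `|lq_delta A w x| ^+ 2)   (* ||delta(w)||^2 > 0 *)
  /\ (forall x, lq_delta A (qword A) x = if x == lq_q A then 1 else 0).

(* Simple: a_r - a_1 = r - 1. *)
Definition simple_lqca (S : finType) (A : lqca S) : Prop :=
  (0 < lq_r A)%N /\
  nth 0 (lq_N A) (lq_r A).-1 - nth 0 (lq_N A) 0 = ((lq_r A).-1)%:Z.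

(* Configurations: maps Z -> Sigma which differ from q at finitely many places. *)
Definition configs (S : finType) (A : lqca S) : set (int -> S) :=
  [set c | finite_set [set i | c i != lq_q A]].

(* c_{i+N} *)
Definition nbhd (S : finType) (A : lqca S) (c : int -> S) (i : int)
  : (lq_r A).-tuple S :=
  [tuple c (i + tnth (lq_N A) j) | j < lq_r A].

(* U_A(d,c) = prod_{i in Z} [delta(c_{i+N})](d_i)  (finitely supported product) *)
Definition UA (S : finType) (A : lqca S) (d c : int -> S) : CC :=
  \big[*%R/1]_(i \in [set: int]) lq_delta A (nbhd A c i) (d i).

(* Inner product on l_2(C_A): <u,v> = sum_d u(d) conj(v(d)). *)
Definition inner (S : finType) (A : lqca S) (u v : (int -> S) -> CC) : CC :=
  \sum_(d \in configs A) u d * (v d)^*.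

(* The columns U_A(., c), c in C_A, are pairwise orthogonal. *)
Definition columns_orthogonal (S : finType) (A : lqca S) : Prop :=
  forall c c', configs A c -> configs A c' -> c <> c' ->
    inner A (fun d => UA A d c) (fun d => UA A d c') = 0.

(** * Algebraic model of computation (unit-cost real-RAM / BSS style over C)

  A machine has integer registers zr : nat -> int, an integer memory
  zm : int -> int and a complex memory cm : int -> CC (indirectly addressed
  by integer registers).  Every instruction costs one unit of time. *)

Inductive instr :=
| ZConst (i : nat) (z : int)              (* zr i := z *)
| ZAdd (i j k : nat)                      (* zr i := zr j + zr k *)
| ZSub (i j k : nat)                      (* zr i := zr j - zr k *)
| ZMul (i j k : nat)                      (* zr i := zr j * zr k *)
| ZLoad (i j : nat)                       (* zr i := zm[zr j] *)
| ZStore (i j : nat)                      (* zm[zr j] := zr i *)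
| ZJumpLe (i j : nat) (t : nat)           (* if zr i <= zr j then goto t *)
| CFromInt (i j : nat)                    (* cm[zr i] := (zr j : CC) *)
| CAdd (i j k : nat)                      (* cm[zr i] := cm[zr j] + cm[zr k] *)
| CSub (i j k : nat)
| CMul (i j k : nat)
| CDiv (i j k : nat)                      (* x / 0 = 0 (MathComp convention) *)
| CConj (i j : nat)                       (* cm[zr i] := conj cm[zr j] *)
| CJumpEq (i j : nat) (t : nat)           (* if cm[zr i] == cm[zr j] then goto t *)
| CJumpLe (i j : nat) (t : nat)           (* if cm[zr i] <= cm[zr j] then goto t *)
| Halt.

Record mstate := MState {
  pc : nat;
  zr : nat -> int;
  zm : int -> int;
  cm : int -> CC
}.

Definition updn {T} (f : nat -> T) (a : nat) (v : T) : nat -> T :=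
  fun x => if x == a then v else f x.
Definition updz {T} (f : int -> T) (a : int) (v : T) : int -> T :=
  fun x => if x == a then v else f x.

(* One step; None when the machine has halted (Halt or pc out of the program). *)
Definition step (P : seq instr) (s : mstate) : option mstate :=
  let: MState p r m c := s in
  let nx := p.+1 in
  let setc i v := Some (MState nx r m (updz c (r i) v)) in
  if (p < size P)%N then
  match nth Halt P p with
  | ZConst i z => Some (MState nx (updn r i z) m c)
  | ZAdd i j k => Some (MState nx (updn r i (r j + r k)) m c)
  | ZSub i j k => Some (MState nx (updn r i (r j - r k)) m c)
  | ZMul i j k => Some (MState nx (updn r i (r j * r k)) m c)
  | ZLoad i j => Some (MState nx (updn r i (m (r j))) m c)
  | ZStore i j => Some (MState nx r (updz m (r j) (r i)) c)
  | ZJumpLe i j t => Some (MState (if r i <= r j then t else nx) r m c)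
  | CFromInt i j => setc i ((r j)%:~R)
  | CAdd i j k => setc i (c (r j) + c (r k))
  | CSub i j k => setc i (c (r j) - c (r k))
  | CMul i j k => setc i (c (r j) * c (r k))
  | CDiv i j k => setc i (c (r j) / c (r k))
  | CConj i j => setc i ((c (r j))^*)
  | CJumpEq i j t => Some (MState (if c (r i) == c (r j) then t else nx) r m c)
  | CJumpLe i j t => Some (MState (if c (r i) <= c (r j) then t else nx) r m c)
  | Halt => None
  end
  else None.

(* run P t s = Some s' iff the machine started in s halts, in final state s',
   within t steps (each executed instruction, including the final halt, costs 1). *)
Fixpoint run (P : seq instr) (t : nat) (s : mstate) : option mstate :=
  match t with
  | 0 => None
  | t'.+1 => match step P s with
             | None => Some s
             | Some s' => run P t' s'
             end
  end.

(** * Encoding of an LQCA as machine input.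
  Sigma is identified with {0,...,k-1} via enum_rank (k = |Sigma|).
  zr 0 = k, zr 1 = r, zr 2 = rank q, zr 3 = a_1; other registers 0.
  zm j = a_{j+1} for 0 <= j < r; 0 elsewhere.
  cm (idx(w) * k + rank x) = delta(w)(x), where idx(w) is the base-k number
  with digits rank w_1 ... rank w_r (w_1 most significant); 0 elsewhere. *)

Definition srank (S : finType) (x : S) : nat := enum_rank x.

Definition word_index (S : finType) (r : nat) (w : r.-tuple S) : nat :=
  foldl (fun acc x => acc * #|S| + srank x)%N 0%N w.

Definition table_index (S : finType) (r : nat) (w : r.-tuple S) (x : S) : int :=
  (word_index w * #|S| + srank x)%:Z.

Definition init_state (S : finType) (A : lqca S) : mstate :=
  MState 0
    (fun i => match i with
              | 0 => #|S|%:Z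
              | 1 => (lq_r A)%:Z
              | 2 => (srank (lq_q A))%:Z
              | 3 => nth 0 (lq_N A) 0
              | _ => 0
              end)
    (fun m => match m with
              | Posz j => if (j < lq_r A)%N then nth 0 (lq_N A) j else 0
              | _ => 0
              end)
    (fun m => \sum_(w : (lq_r A).-tuple S) \sum_(x : S)
                 if table_index w x == m then lq_delta A w x else 0).

(* Main.v *)
(** Since <U(.,c), U(.,c')> is the product over i of
    <delta(c_{i+N}), delta(c'_{i+N})>, two distinct configurations have
    non-orthogonal columns iff none of these local overlaps vanishes.  Read c
    and c' from left to right, as a walk on pairs (w, w') of r-letter words: it
    starts at the first difference of c and c', in a pair with equal prefixes and
    distinct last letters, visits only pairs with a nonzero overlap, and may stop
    once the last r-1 letters agree, as both configurations can then be continued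
    by q (equal words overlap, because ||delta(w)|| > 0).  Conversely every such
    walk gives two configurations.  Hence orthogonality fails iff a graph search
    over the k^(2r) pairs, each with k^2 successors and an overlap computed in
    time O(k), meets such a final pair: time O(k^(2r+2)) = O(n^2). *)
Require Import Defs.
From mathcomp Require Import all_boot all_order all_algebra.
From mathcomp Require Import boolp classical_sets functions cardinality fsbigop.
From mathcomp Require Import Rstruct complex zify ring.
Set Implicit Arguments. Unset Strict Implicit. Unset Printing Implicit Defensive.
Import Order.TTheory GRing.Theory Num.Theory.
Local Open Scope ring_scope.

(** * Structured programs *)

(** The bound leaves time O(k^2) for each of the k^(2r) pairs. Overlaps are therefore evaluated when
    a pair leaves the stack, once per pair; once per edge would cost a further factor k. The
    successors of a pair depend only on its residues modulo k^(r-1), found in time O(k). The running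
    time concerns a concrete program with absolute jumps. The search is written in a small
    structured language whose executions carry their exact step count, and one compilation lemma
    transfers both result and count to the machine. Correctness is split likewise: the program
    realizes operations on two lists of pairs, the marks and the stack, and the invariants of graph
    search are proved for these lists. *)

Record store := Store { rg : nat -> int; im : int -> int; xm : int -> CC }.

Definition at_pc (p : nat) (d : store) : mstate := MState p (rg d) (im d) (xm d).

Definition effect (d : store) (i : instr) : store :=
  if step [:: i] (at_pc 0 d) is Some s then Store (zr s) (zm s) (cm s) else d.

Definition straight (i : instr) : bool :=
  match i with
  | ZJumpLe _ _ _ | CJumpEq _ _ _ | CJumpLe _ _ _ | Halt => false
  | _ => true
  end.

Inductive cmd :=
| Block of seq instr
| Seq of cmd & cmd
| UnlessLe of nat & nat & cmd
| UnlessCEq of nat & nat & cmd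
| UntilLe of nat & nat & cmd.

Fixpoint csize (c : cmd) : nat :=
  match c with
  | Block l => size l
  | Seq c1 c2 => csize c1 + csize c2
  | UnlessLe _ _ c1 | UnlessCEq _ _ c1 => (csize c1).+1
  | UntilLe _ _ c1 => (csize c1).+2
  end.

Fixpoint compile (p : nat) (c : cmd) : seq instr :=
  match c with
  | Block l => l
  | Seq c1 c2 => compile p c1 ++ compile (p + csize c1) c2
  | UnlessLe i j c1 => ZJumpLe i j (p + (csize c1).+1) :: compile p.+1 c1
  | UnlessCEq i j c1 => CJumpEq i j (p + (csize c1).+1) :: compile p.+1 c1
  | UntilLe i j c1 =>
      ZJumpLe i j (p + (csize c1).+2) :: compile p.+1 c1 ++ [:: ZJumpLe 0 0 p]
  end.

(** The index counts machine steps exactly: a round of a loop costs two more than its body, for the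
    test and the jump back. *)
Inductive exec : cmd -> nat -> store -> store -> Prop :=
| ExecBlock l d of all straight l : exec (Block l) (size l) d (foldl effect d l)
| ExecSeq c1 c2 t1 t2 d1 d2 d3 of exec c1 t1 d1 d2 & exec c2 t2 d2 d3 :
    exec (Seq c1 c2) (t1 + t2) d1 d3
| ExecUnlessLe_skip i j c d of rg d i <= rg d j : exec (UnlessLe i j c) 1 d d
| ExecUnlessLe i j c t d d' of rg d j < rg d i & exec c t d d' :
    exec (UnlessLe i j c) t.+1 d d'
| ExecUnlessCEq_skip i j c d of xm d (rg d i) = xm d (rg d j) :
    exec (UnlessCEq i j c) 1 d d
| ExecUnlessCEq i j c t d d' of xm d (rg d i) <> xm d (rg d j) & exec c t d d' :
    exec (UnlessCEq i j c) t.+1 d d'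
| ExecUntil_stop i j c d of rg d i <= rg d j : exec (UntilLe i j c) 1 d d
| ExecUntil i j c t1 t2 d1 d2 d3 of rg d1 j < rg d1 i & exec c t1 d1 d2
    & exec (UntilLe i j c) t2 d2 d3 : exec (UntilLe i j c) (t1 + t2).+2 d1 d3.

Lemma size_compile c p : size (compile p c) = csize c.
Proof.
elim: c p => //= [c1 IH1 c2 IH2|i j c IH|i j c IH|i j c IH] p.
- by rewrite size_cat IH1 IH2.
- by rewrite IH.
- by rewrite IH.
- by rewrite size_cat IH /= addn1.
Qed.

(** Quantifying over the remaining fuel [T] lets runs be chained without knowing whether the machine
    halts later. *)
Definition reaches (P : seq instr) (t : nat) (s s' : mstate) : Prop :=
  forall T, run P (t + T) s = run P T s'.

Lemma reaches_trans P t1 t2 s1 s2 s3 :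
  reaches P t1 s1 s2 -> reaches P t2 s2 s3 -> reaches P (t1 + t2) s1 s3.
Proof. by move=> h1 h2 T; rewrite -addnA h1 h2. Qed.

Lemma reaches_step P s s' : step P s = Some s' -> reaches P 1 s s'.
Proof. by move=> h T; rewrite add1n /= h. Qed.

Lemma reaches1 P pre i post d s' : P = pre ++ i :: post ->
  step [:: i] (at_pc 0 d) = Some s' -> straight i ->
  reaches P 1 (at_pc (size pre) d) (at_pc (size pre).+1 (effect d i)).
Proof.
move=> eP hs hi; apply: reaches_step; rewrite /effect hs eP {1}/step /at_pc.
have -> : (size pre < size (pre ++ i :: post))%N by rewrite size_cat /=; lia.
rewrite nth_cat ltnn subnn /=.
by move: hs hi; rewrite /step /=; case: i eP => //= *; match goal with
 H : Some _ = Some _ |- _ => case: H => <- end.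
Qed.

Lemma step_jump P pre i post d : P = pre ++ i :: post ->
  match i with
  | ZJumpLe i j t => step P (at_pc (size pre) d) =
      Some (at_pc (if rg d i <= rg d j then t else (size pre).+1) d)
  | CJumpEq i j t => step P (at_pc (size pre) d) =
      Some (at_pc (if xm d (rg d i) == xm d (rg d j) then t else (size pre).+1) d)
  | _ => True
  end.
Proof.
move=> eP; have lt : (size pre < size P)%N by rewrite eP size_cat /=; lia.
have en : nth Halt P (size pre) = i by rewrite eP nth_cat ltnn subnn.
by case: i eP en => // i j t _ en; rewrite /step /at_pc lt en.
Qed.

(** Induction on the derivation. The context [pre], [post] is generalized because the parts of a
    command sit at different addresses of one program. *)
Lemma compile_correct c t d d' : exec c t d d' ->
  forall P pre post, P = pre ++ compile (size pre) c ++ post ->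
  reaches P t (at_pc (size pre) d) (at_pc (size pre + csize c) d').
Proof.
elim => {c t d d'} /=.
- move=> l d; elim: l d => [|i l IH] d /= hl P pre post eP.
    by move=> T; rewrite addn0.
  case/andP: hl => hi hl.
  have [s' hs] : exists s', step [:: i] (at_pc 0 d) = Some s'.
    by case: i hi {eP} => // *; eexists.
  have h1 := @reaches1 P pre i (l ++ post) d s' eP hs hi.
  have h2 := IH (effect d i) hl P (rcons pre i) post.
  rewrite size_rcons cat_rcons in h2; rewrite -[(size l).+1]add1n addnA addn1.
  exact: reaches_trans h1 (h2 eP).
- move=> c1 c2 t1 t2 d1 d2 d3 _ IH1 _ IH2 P pre post eP; rewrite addnA.
  apply: reaches_trans; first by apply: (IH1 P pre (compile (size pre + csize c1) c2 ++ post)); rewrite eP -!catA.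
  have := IH2 P (pre ++ compile (size pre) c1) post.
  rewrite size_cat size_compile; apply.
  by rewrite eP -!catA.
- move=> i j c d h P pre post eP; apply: reaches_step.
  by rewrite (step_jump _ eP) h.
- move=> i j c t d d' h _ IH P pre post eP; rewrite -add1n.
  apply: reaches_trans; first by apply: reaches_step; rewrite (step_jump _ eP) leNgt h.
  have := IH P (rcons pre (ZJumpLe i j (size pre + (csize c).+1))) post.
  by rewrite size_rcons cat_rcons addSnnS; apply.
- move=> i j c d h P pre post eP; apply: reaches_step.
  by rewrite (step_jump _ eP) h eqxx.
- move=> i j c t d d' /eqP /negbTE h _ IH P pre post eP; rewrite -add1n.
  apply: reaches_trans; first by apply: reaches_step; rewrite (step_jump _ eP) h.
  have := IH P (rcons pre (CJumpEq i j (size pre + (csize c).+1))) post.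
  by rewrite size_rcons cat_rcons addSnnS; apply.
- move=> i j c d h P pre post eP; apply: reaches_step.
  by rewrite (step_jump _ eP) h.
- move=> i j c t1 t2 d1 d2 d3 h _ IH1 _ IH2 P pre post eP.
  have -> : ((t1 + t2).+2 = 1 + (t1 + (1 + t2)))%N by lia.
  apply: reaches_trans; first by apply: reaches_step; rewrite (step_jump _ eP) leNgt h.
  rewrite -catA in eP; apply: reaches_trans.
    have := IH1 P (rcons pre (ZJumpLe i j (size pre + (csize c).+2))) (ZJumpLe 0 0 (size pre) :: post).
    by rewrite size_rcons cat_rcons; apply.
  apply: reaches_trans; last by apply: (IH2 P pre post); rewrite -catA.
  set pre' := pre ++ ZJumpLe i j (size pre + (csize c).+2) :: compile (size pre).+1 c.
  have e : ((size pre).+1 + csize c = size pre')%N.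
    by rewrite size_cat [size (_ :: _)]/= size_compile addnS.
  have := step_jump (pre := pre') (i := ZJumpLe 0 0 (size pre)) (post := post) d2.
  rewrite e lexx => hs.
  by apply: reaches_step; apply: hs; rewrite eP -catA.
Qed.

Lemma compile_run c t B d d' : exec c t d d' -> (t < B)%N ->
  run (compile 0 c) B (at_pc 0 d) = Some (at_pc (csize c) d').
Proof.
move=> /compile_correct /(_ (compile 0 c) [::] [::]).
rewrite cats0 add0n => /(_ erefl) h ltB.
(* Behind the last instruction [step] yields [None], and noticing this takes one more unit of fuel:
   hence the strict bound [t < B]. *)
have -> : B = (t + (B - t).-1.+1)%N by lia.
rewrite h /= size_compile ltnn; reflexivity.
Qed.

(** * Registers left unchanged by a command *)

Definition written (i : instr) : seq nat :=
  match i with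
  | ZConst i _ | ZAdd i _ _ | ZSub i _ _ | ZMul i _ _ | ZLoad i _ => [:: i]
  | _ => [::]
  end.

Fixpoint modified (c : cmd) : seq nat :=
  match c with
  | Block l => flatten (map written l)
  | Seq c1 c2 => modified c1 ++ modified c2
  | UnlessLe _ _ c1 | UnlessCEq _ _ c1 | UntilLe _ _ c1 => modified c1
  end.

Lemma effect_frame i d x : x \notin written i -> rg (effect d i) x = rg d x.
Proof.
by case: i => [i z|i j k|i j k|i j k|i j|i j|i j t|i j|i j k|i j k|i j k|i j k|i j|i j t|i j t|];
  rewrite /= ?inE => h; rewrite /effect /step /at_pc /= /updn ?(negbTE h).
Qed.

Lemma exec_frame c t d d' x : exec c t d d' -> x \notin modified c ->
  rg d' x = rg d x.
Proof.
elim => {c t d d'} //=.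
- move=> l d _; elim: l d => //= i l IH d.
  rewrite mem_cat negb_or => /andP[hi hl]; rewrite IH //.
  exact: effect_frame.
- move=> c1 c2 t1 t2 d1 d2 d3 _ IH1 _ IH2; rewrite mem_cat negb_or => /andP[h1 h2].
  by rewrite IH2 ?IH1.
- by move=> i j c t1 t2 d1 d2 d3 _ _ IH1 _ IH2 h; rewrite IH2 ?IH1.
Qed.

(** * Total correctness with time bounds *)

Definition runs (t : nat) (c : cmd) (d : store) (Q : store -> Prop) : Prop :=
  exists t' d', [/\ (t' <= t)%N, exec c t' d d' & Q d'].

Lemma runs_frame t c d Q : runs t c d Q ->
  runs t c d (fun d' => Q d' /\ forall x, x \notin modified c -> rg d' x = rg d x).
Proof.
move=> [t' [d' [h1 h2 h3]]]; exists t', d'; split=> //; split=> // x.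
exact: exec_frame h2.
Qed.

Lemma runs_weaken t t' c d (Q Q' : store -> Prop) : runs t c d Q -> (t <= t')%N ->
  (forall d', Q d' -> Q' d') -> runs t' c d Q'.
Proof.
move=> [u [d' [h1 h2 h3]]] htt hQ; exists u, d'; split=> //; last exact: hQ.
exact: leq_trans htt.
Qed.

Lemma runs_block t l d (Q : store -> Prop) : (size l <= t)%N -> all straight l ->
  Q (foldl effect d l) -> runs t (Block l) d Q.
Proof.
by move=> ht hl hQ; exists (size l), (foldl effect d l); split=> //; constructor.
Qed.

Lemma runs_seq t1 t2 c1 c2 d Q R : runs t1 c1 d R ->
  (forall d', R d' -> runs t2 c2 d' Q) -> runs (t1 + t2) (Seq c1 c2) d Q.
Proof.
move=> [u1 [d1 [h1 h2 h3]]] /(_ _ h3) [u2 [d2 [h4 h5 h6]]].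
by exists (u1 + u2)%N, d2; split; [exact: leq_add | exact: ExecSeq h2 h5 |].
Qed.

Lemma runs_unless t i j c d (Q : store -> Prop) : (rg d i <= rg d j -> Q d) ->
  (rg d j < rg d i -> runs t c d Q) -> runs t.+1 (UnlessLe i j c) d Q.
Proof.
move=> h1 h2; case: (leP (rg d i) (rg d j)) => h.
  by exists 1, d; split=> //; [exact: ExecUnlessLe_skip | exact: h1].
have [u [d' [? ? ?]]] := h2 h.
by exists u.+1, d'; split=> //; exact: ExecUnlessLe.
Qed.

Lemma runs_unlessC t i j c d (Q : store -> Prop) :
  (xm d (rg d i) = xm d (rg d j) -> Q d) ->
  (xm d (rg d i) <> xm d (rg d j) -> runs t c d Q) ->
  runs t.+1 (UnlessCEq i j c) d Q.
Proof.
move=> h1 h2; case: (pselect (xm d (rg d i) = xm d (rg d j))) => h.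
  by exists 1, d; split=> //; [exact: ExecUnlessCEq_skip | exact: h1].
have [u [d' [? ? ?]]] := h2 h.
by exists u.+1, d'; split=> //; exact: ExecUnlessCEq.
Qed.

(** The index of [I] bounds the rounds left. A round may lower it by more than one; this happens
    when the discovery of a final pair empties the stack. *)
Lemma runs_until (I : nat -> store -> Prop) t i j c n d :
  (forall a d, I a d -> if rg d i <= rg d j then True
     else exists2 b, a = b.+1 & runs t c d (fun d' => exists2 b', (b' <= b)%N & I b' d')) ->
  I n d ->
  runs (n * t.+2).+1 (UntilLe i j c) d
    (fun d' => rg d' i <= rg d' j /\ exists a, I a d').
Proof.
move=> hI; elim/ltn_ind: n d => n IH d hd.
move: (hI _ _ hd); case: leP => h.
  by exists 1, d; split=> //; [exact: ExecUntil_stop | split=> //; exists n].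
move=> [b eb [u [d' [h1 h2 [b' hb' h3]]]]].
have [] := IH b' _ d' h3; first by rewrite eb ltnS.
move=> u' [d'' [h4 h5 h6]]; exists (u + u').+2, d''; split=> //.
  by rewrite eb; nia.
exact: ExecUntil h2 h5.
Qed.

Lemma runs_for (I : nat -> store -> Prop) t i j c n d :
  (forall a d, (a <= n)%N -> I a d -> (rg d i <= rg d j) = (a == n)) ->
  (forall a d, (a < n)%N -> I a d -> runs t c d (I a.+1)) ->
  I 0 d -> runs (n * t.+2).+1 (UntilLe i j c) d (I n).
Proof.
move=> hg hI h0.
have := @runs_until (fun b d => (b <= n)%N /\ I (n - b)%N d) t i j c n d.
move=> H; apply: runs_weaken (H _ _) (leqnn _) _ => [b d1 [hb hd1]||].
- rewrite (hg _ _ _ hd1) ?leq_subr //; case: eqP => // ne.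
  case: b hb hd1 ne => [|b] hb hd1 ne; first by lia.
  exists b => //; apply: runs_weaken (hI (n - b.+1)%N _ _ hd1) (leqnn _) _; first by lia.
  move=> d' hd'; exists b => //; split; first exact: ltnW.
  by have -> : (n - b = (n - b.+1).+1)%N by lia.
- by rewrite subnn.
- move=> d' [hle [a [ha hd']]]; move: hle; rewrite (hg _ _ _ hd') ?leq_subr // => /eqP e.
  by rewrite -e.
Qed.

Lemma effectE r m c :
  (forall i z, effect (Store r m c) (ZConst i z) = Store (updn r i z) m c) *
  (forall i j k, effect (Store r m c) (ZAdd i j k) = Store (updn r i (r j + r k)) m c) *
  (forall i j k, effect (Store r m c) (ZSub i j k) = Store (updn r i (r j - r k)) m c) *
  (forall i j k, effect (Store r m c) (ZMul i j k) = Store (updn r i (r j * r k)) m c) *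
  (forall i j, effect (Store r m c) (ZLoad i j) = Store (updn r i (m (r j))) m c) *
  (forall i j, effect (Store r m c) (ZStore i j) = Store r (updz m (r j) (r i)) c) *
  (forall i j, effect (Store r m c) (CFromInt i j) =
     Store r m (updz c (r i) (r j)%:~R)) *
  (forall i j k, effect (Store r m c) (CAdd i j k) =
     Store r m (updz c (r i) (c (r j) + c (r k)))) *
  (forall i j k, effect (Store r m c) (CMul i j k) =
     Store r m (updz c (r i) (c (r j) * c (r k)))) *
  (forall i j, effect (Store r m c) (CConj i j) =
     Store r m (updz c (r i) ((c (r j))^*))).
Proof. by []. Qed.

(** * The search program *)

(* Registers: 0 = k, 1 = r, 4 = 0, 5 = 1, 6 = M = k^(r-1), 7 = k^r, 29 = M - 1,
   8 = number of stack cells in use, 9 = 1 once a final pair has been met,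
   10 = current seed, (11, 12) = current pair, (13, 14) = its residues mod M.
   The mark of the pair (w, w') is the integer cell -1 - (w k^r + w'), as negative
   cells start out as 0; the stack occupies the integer cells from 0 on, two per
   pair; complex cells -1, -2, -3 are scratch. *)
Definition visit_child : cmd :=
  Seq (Block [:: ZAdd 12 27 16; ZSub 17 11 12; ZMul 17 17 17])
 (Seq (UnlessLe 17 4
        (Seq (Block [:: ZMul 18 11 7; ZAdd 18 18 12; ZConst 19 (-1); ZSub 18 19 18;
                        ZLoad 19 18])
             (UnlessLe 5 19
                (Block [:: ZStore 5 18; ZStore 11 8; ZAdd 8 8 5; ZStore 12 8;
                           ZAdd 8 8 5]))))
      (Block [:: ZAdd 16 16 5])).

Definition visit_row : cmd :=
  Seq (Block [:: ZAdd 11 26 15; ZConst 16 0])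
 (Seq (UntilLe 0 16 visit_child)
      (Block [:: ZAdd 15 15 5])).

Definition visit_children : cmd :=
  Seq (Block [:: ZMul 26 13 0; ZMul 27 14 0; ZConst 15 0])
      (UntilLe 0 15 visit_row).

(** The machine has no integer division, so residues modulo [M] come from repeated subtraction,
    fewer than [k] times for a word code below [k * M]. Register 29 holds [M - 1] because the test
    is a weak inequality. *)
Definition reduce (i : nat) : cmd := UntilLe i 29 (Block [:: ZSub i i 6]).

Definition overlap : cmd :=
  Seq (Block [:: ZMul 23 11 0; ZMul 24 12 0; ZConst 25 0; ZConst 20 (-1);
                 ZConst 21 (-2); ZConst 22 (-3); CFromInt 20 25; CFromInt 22 25])
      (UntilLe 0 25 (Block [:: CConj 21 24; CMul 21 23 21; CAdd 20 20 21;
                               ZAdd 23 23 5; ZAdd 24 24 5; ZAdd 25 25 5])).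

(** Integers are compared only by [<=], so equality of the residues is tested through the square of
    their difference, which is either 0 or at least 1. Setting register 8 to 0 empties the stack and
    thereby ends the search. *)
Definition expand : cmd :=
  Seq (Block [:: ZAdd 13 11 4; ZAdd 14 12 4])
 (Seq (reduce 13)
 (Seq (reduce 14)
 (Seq (Block [:: ZSub 32 13 14; ZMul 32 32 32])
 (Seq (UnlessLe 5 32 (Block [:: ZConst 9 1; ZConst 8 0]))
      (UnlessLe 32 4 visit_children))))).

Definition process : cmd :=
  Seq (Block [:: ZSub 8 8 5; ZLoad 12 8; ZSub 8 8 5; ZLoad 11 8])
 (Seq overlap
      (UnlessCEq 20 22 expand)).

Definition search : cmd :=
  Seq (Block [:: ZConst 6 1; ZConst 30 1])
 (Seq (UntilLe 1 30 (Block [:: ZMul 6 6 0; ZAdd 30 30 5]))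
 (Seq (Block [:: ZMul 7 6 0; ZSub 29 6 5; ZConst 10 0])
 (Seq (UntilLe 6 10
        (Seq (Block [:: ZAdd 13 10 4; ZAdd 14 10 4])
        (Seq visit_children
             (Block [:: ZAdd 10 10 5]))))
 (Seq (UntilLe 8 4 process)
      (Block [:: ZSub 0 5 9]))))).

(* For k = 1 the time bound is a constant although r is unbounded, so that not
   even k^(r-1) can be computed; register 0 then already holds the answer 1. *)
Definition decide : cmd :=
  Seq (Block [:: ZConst 5 1]) (UnlessLe 0 5 search).

(** * Abstract search states and their representation in memory *)

Notation node := (nat * nat)%type.

(* A search state consists of the marked pairs and of the stack, whose top is
   the last entry. *)
Definition push (st : seq node * seq node) (p : node) : seq node * seq node :=
  if (p.1 == p.2) || (p \in st.1) then st else (rcons st.1 p, rcons st.2 p).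

Definition push_row (k m m' x n : nat) st :=
  iteri n (fun y st => push st (m * k + x, m' * k + y)%N) st.

Definition push_rows (k m m' n : nat) st :=
  iteri n (fun x st => push_row k m m' x k st) st.

Record represents (k M : nat) (tab : nat -> CC) (st : seq node * seq node)
    (d : store) : Prop := Represents {
  rep_k : rg d 0 = k;
  rep_0 : rg d 4 = 0;
  rep_1 : rg d 5 = 1;
  rep_M : rg d 6 = M;
  rep_W : rg d 7 = (k * M)%N;
  rep_M1 : rg d 29 = M%:Z - 1;
  rep_size : rg d 8 = (size st.2).*2;
  rep_mark : forall w w', (w < k * M)%N -> (w' < k * M)%N ->
    im d (-1 - (w * (k * M) + w')%N%:Z) = ((w, w') \in st.1);
  rep_stack : forall i, (i < size st.2)%N ->
    im d i.*2 = (nth (0, 0) st.2 i).1 /\ im d i.*2.+1 = (nth (0, 0) st.2 i).2;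
  rep_tab : forall a : nat, xm d a = tab a }.

Ltac crunch := rewrite /= ?effectE /= /updn /=.

Lemma pair_code_inj W a b a' b' : (b < W)%N -> (b' < W)%N ->
  (a * W + b = a' * W + b')%N -> a = a' /\ b = b'.
Proof.
move=> h h' e; have W0 : (0 < W)%N by lia.
have := congr1 (divn^~ W) e; rewrite /= !divnMDl // !divn_small // !addn0.
by have := congr1 (modn^~ W) e; rewrite /= !modnMDl !modn_small.
Qed.

Lemma visit_child_runs k M tab st d w mk' y :
  represents k M tab st d -> rg d 11 = w%:Z -> rg d 27 = mk'%:Z -> rg d 16 = y%:Z ->
  (w < k * M)%N -> (mk' + y < k * M)%N ->
  runs 16 visit_child d (fun d' =>
    [/\ represents k M tab (push st (w, mk' + y)%N) d' & rg d' 16 = y.+1]).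
Proof.
move=> hrep h11 h27 h16 hw hw'.
rewrite /visit_child.
apply: (@runs_seq 3 13 _ _ _ _ (fun d' => [/\ represents k M tab st d',
   rg d' 11 = w, rg d' 12 = (mk' + y)%N, rg d' 16 = y &
   rg d' 17 = (w%:Z - (mk' + y)%N%:Z) ^+ 2])).
  apply: runs_block => //.
  case: d hrep h11 h27 h16 => r m c [] *; simpl in *; crunch; split=> //.
  - by lia.
  - by rewrite expr2; congr (_ * _); lia.
move=> {h11 h27 h16 hrep} d [hrep h11 h12 h16 h17].
apply: (@runs_seq 12 1 _ _ _ _ (fun d' => [/\ represents k M tab (push st (w, mk' + y)%N) d' & rg d' 16 = y])); last first.
  move=> d' [hr h]; apply: runs_block => //.
  case: d' hr h => r m c [] *; simpl in *; crunch; split=> //.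
  by lia.
apply: runs_unless.
  rewrite h17 (rep_0 hrep) => hle; split=> //; rewrite /push /=.
  have -> : (w == (mk' + y)%N) by apply/eqP; nia.
  by [].
rewrite h17 (rep_0 hrep) => hlt.
have /negbTE ne : w != (mk' + y)%N.
  by apply/eqP => e; move: hlt; rewrite e subrr expr0n ltxx.
apply: (@runs_seq 5 6 _ _ _ _ (fun d' => represents k M tab st d' /\ [/\
   rg d' 11 = w, rg d' 12 = (mk' + y)%N, rg d' 16 = y,
   rg d' 18 = -1 - (w * (k * M) + (mk' + y))%N%:Z &
   rg d' 19 = ((w, mk' + y)%N \in st.1)])).
  apply: runs_block => //.
  have hm := rep_mark hrep hw hw'.
  case: d hrep h11 h12 h16 h17 hm => r m c [] /= r0 r4 r5 r6 r7 r29 r8 hmark hstk htab h11 h12 h16 h17 hm.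
  crunch.
  have e : -1 - (r 11 * r 7 + r 12) = -1 - (w * (k * M) + (mk' + y))%N%:Z.
    by rewrite h11 r7 h12; lia.
  by rewrite e; split=> //; split.
move=> {h11 h12 h16 h17 hrep hlt} d [hrep [h11 h12 h16 h18 h19]].
apply: runs_unless.
  rewrite h19 (rep_1 hrep) => hle; split=> //; rewrite /push ne /=.
  by case: (_ \in _) hle.
rewrite h19 (rep_1 hrep) => hlt; apply: runs_block => //.
have /negbTE nin : (w, mk' + y)%N \notin st.1 by case: (_ \in _) hlt.
rewrite /push ne nin /=.
case: d hrep h11 h12 h16 h18 h19 => r m c [] /= r0 r4 r5 r6 r7 r29 r8 hmark hstk htab h11 h12 h16 h18 h19.
crunch; split=> //; split=> //=.
- by rewrite r8 r5 size_rcons; lia.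
(* Marks lie below 0 and stack cells from 0 on, so the two writes to the stack touch no mark; among
   marks the address determines the pair. *)
- move=> a b ha hb; rewrite h18 r8 r5 /updz.
  case: eqP => [|_]; first by lia.
  case: eqP => [|_]; first by lia.
  rewrite mem_rcons inE; case: eqP => e.
    have [-> ->] : a = w /\ b = (mk' + y)%N by apply: (@pair_code_inj (k * M)) => //; lia.
    by rewrite eqxx.
  rewrite hmark //; case: eqP => // -[ea eb]; subst; lia.
- move=> i; rewrite size_rcons ltnS => hi; rewrite h18 r8 r5 /updz nth_rcons.
  case: ltngtP hi => // [hi _|-> _].
    have [<- <-] := hstk _ hi.
    by split; repeat (case: eqP => [|_]; [by lia|]).
  rewrite h11 h12; split; last by case: eqP => //; lia.
  by case: eqP => [|_]; [lia|case: eqP => //; lia].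
Qed.

Lemma child_bound k M m x : (m < M)%N -> (x < k)%N -> (m * k + x < k * M)%N.
Proof. by move=> hm hx; nia. Qed.

Lemma visit_row_runs k M tab st d (m m' x : nat) :
  represents k M tab st d -> rg d 26 = (m * k)%N -> rg d 27 = (m' * k)%N ->
  rg d 15 = x -> (m < M)%N -> (m' < M)%N -> (x < k)%N ->
  runs (18 * k + 4) visit_row d (fun d' =>
    represents k M tab (push_row k m m' x k st) d' /\ rg d' 15 = x.+1).
Proof.
move=> hrep h26 h27 h15 hm hm' hx.
have -> : (18 * k + 4 = 2 + ((k * 18).+1 + 1))%N by lia.
pose I n d' := represents k M tab (push_row k m m' x n st) d' /\
  [/\ rg d' 11 = (m * k + x)%N, rg d' 16 = n, rg d' 27 = (m' * k)%N & rg d' 15 = x].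
apply: (@runs_seq _ _ _ _ _ _ (I 0)).
  apply: runs_block => //.
  case: d hrep h26 h27 h15 => r m0 c [] *; simpl in *; crunch; split=> //.
  by split=> //=; lia.
move=> {h26 h27 h15 hrep} d hI.
apply: (@runs_seq _ _ _ _ _ _ (I k)); last first.
  move=> d' [hr [h11 h16 h27 h15]]; apply: runs_block => //.
  case: d' hr h11 h16 h27 h15 => r m0 c [] *; simpl in *; crunch; split=> //; lia.
apply: runs_for hI => [a d' ha [hr [_ h16 _ _]]|a d' ha [hr [h11 h16 h27 h15]]].
  by rewrite h16 (rep_k hr); apply/idP/eqP; lia.
have h := visit_child_runs hr h11 h27 h16 (child_bound hm hx) (child_bound hm' ha).
apply: runs_weaken (runs_frame h) (leqnn _) _ => d'' [[hr' h16'] fr].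
by split=> //; split=> //; rewrite fr.
Qed.

Lemma visit_children_runs k M tab st d (m m' : nat) :
  represents k M tab st d -> rg d 13 = m -> rg d 14 = m' -> (m < M)%N -> (m' < M)%N ->
  runs (3 + (k * (18 * k + 6)).+1) visit_children d
    (represents k M tab (push_rows k m m' k st)).
Proof.
move=> hrep h13 h14 hm hm'.
pose I n d' := represents k M tab (push_rows k m m' n st) d' /\
  [/\ rg d' 26 = (m * k)%N, rg d' 27 = (m' * k)%N & rg d' 15 = n].
apply: (@runs_seq _ _ _ _ _ _ (I 0)).
  apply: runs_block => //.
  case: d hrep h13 h14 => r m0 c [] /= r0 *; simpl in *; crunch; split=> //.
  by split=> //=; rewrite r0; lia.
move=> {h13 h14 hrep} d hI.
apply: (@runs_weaken _ _ _ _ (I k)) (leqnn _) _; last by move=> d' [].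
have -> : (18 * k + 6 = (18 * k + 4).+2)%N by lia.
apply: runs_for hI => [a d' ha [hr [_ _ h15]]|a d' ha [hr [h26 h27 h15]]].
  by rewrite h15 (rep_k hr); apply/idP/eqP; lia.
have h := visit_row_runs hr h26 h27 h15 hm hm' ha.
apply: runs_weaken (runs_frame h) (leqnn _) _ => d'' [[hr' h15'] fr].
by split=> //; split=> //; rewrite fr.
Qed.

Lemma divn_stepE w M a : (0 < M)%N -> (a <= w %/ M)%N ->
  (w%:Z - (a * M)%N%:Z <= M%:Z - 1) = (a == w %/ M)%N.
Proof.
move=> M0 ha; have := divn_eq w M; have := ltn_pmod w M0.
move: (w %/ M)%N (w %% M)%N ha => q s ha hs e.
by apply/idP/eqP; nia.
Qed.

Lemma reduce_runs k M tab st d i (w : nat) :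
  i \notin [:: 0; 4; 5; 6; 7; 29; 8] -> (0 < M)%N -> (w < k * M)%N ->
  represents k M tab st d -> rg d i = w ->
  runs (3 * k).+1 (reduce i) d
    (fun d' => represents k M tab st d' /\ rg d' i = (w %% M)%N).
Proof.
move=> hi M0 hw hrep hri.
have hq : (w %/ M < k)%N by rewrite ltn_divLR.
pose I a d' := represents k M tab st d' /\ rg d' i = w%:Z - (a * M)%N%:Z.
apply: (@runs_weaken ((w %/ M) * 3).+1%N _ _ _ (I (w %/ M)%N)); last 2 first.
- by lia.
- by move=> d' [hr ->]; split=> //; have := divn_eq w M; lia.
apply: runs_for => [a d' ha [hr e]|a d' ha [hr e]|]; last by split=> //; lia.
  by rewrite e (rep_M1 hr) divn_stepE.
apply: runs_block => //.
move: hi; rewrite !inE !negb_or => /and5P[i0 i1 i2 i3 /and3P[i4 i5 i6]].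
case: d' hr e => r m c [] *; simpl in *; rewrite effectE; split=> /=; last first.
  by rewrite /updn eqxx; lia.
by split=> //=; rewrite /updn eq_sym ?(negbTE i0) ?(negbTE i1) ?(negbTE i2) ?(negbTE i3)
 ?(negbTE i4) ?(negbTE i5) ?(negbTE i6).
Qed.

Definition overlapn (k : nat) (tab : nat -> CC) (w w' : nat) : CC :=
  \sum_(z < k) tab (w * k + z)%N * (tab (w' * k + z)%N)^*.

Lemma overlap_runs k M tab st d (w w' : nat) :
  represents k M tab st d -> rg d 11 = w -> rg d 12 = w' ->
  runs (8 * k + 9) overlap d (fun d' => represents k M tab st d' /\
    xm d' (rg d' 20) = overlapn k tab w w' /\ xm d' (rg d' 22) = 0).
Proof.
move=> hrep h11 h12.
have -> : (8 * k + 9 = 8 + (k * 8).+1)%N by lia.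
pose J n d' := represents k M tab st d' /\
    [/\ rg d' 20 = -1, rg d' 21 = -2, rg d' 22 = -3 & xm d' (-3) = 0] /\
    [/\ xm d' (-1) = \sum_(z < n) tab (w * k + z)%N * (tab (w' * k + z)%N)^*,
        rg d' 23 = (w * k + n)%N, rg d' 24 = (w' * k + n)%N & rg d' 25 = n].
apply: (@runs_seq _ _ _ _ _ _ (J 0)).
  apply: runs_block => //.
  case: d hrep h11 h12 => r m c [] /= r0 *; simpl in *; crunch; split=> //.
  split=> /=; first by split=> //=; rewrite /updz /=.
  by rewrite /updz /= big_ord0 r0; split=> //; lia.
move=> {h11 h12 hrep} d hJ.
apply: (@runs_weaken _ _ _ _ (J k)) (leqnn _) _; last first.
  by move=> d' [hr [[h20 h21 h22 z3] [z1 _ _ _]]]; split=> //; rewrite h20 h22.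
apply: runs_for hJ => [a d' ha [hr [_ [_ _ _ h25]]]|a d' ha [hr [hs1 hs2]]].
  by rewrite h25 (rep_k hr); apply/idP/eqP; lia.
apply: runs_block => //.
case: d' hr hs1 hs2 => r m c [] /= r0 r4 r5 r6 r7 r29 r8 hmark hstk htab.
move=> [h20 h21 h22 z3] [z1 h23 h24 h25]; crunch.
split; first by split=> //= a'; rewrite h20 h21 /updz /= htab.
rewrite ?r5 ?h20 ?h21 ?h22 ?h23 ?h24 ?h25; split=> /=; first by rewrite /updz /=.
split; [|by lia..].
rewrite /updz /= ?htab z1 big_ord_recr /=.
by [].
Qed.
(* Words are coded in base k, so that [w %% M] drops the first letter of w. *)
Inductive reached (k M : nat) (tab : nat -> CC) : node -> Prop :=
| ReachedSeed u x y of (u < M)%N & (x < k)%N & (y < k)%N & x <> y :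
    reached k M tab (u * k + x, u * k + y)%N
| ReachedChild p x y of reached k M tab p & overlapn k tab p.1 p.2 <> 0
    & (p.1 %% M <> p.2 %% M)%N & (x < k)%N & (y < k)%N :
    reached k M tab ((p.1 %% M) * k + x, (p.2 %% M) * k + y)%N.

(** For [r = 1] the modulus [M] is 1 and the residues always agree: any two distinct letters with
    nonzero overlap form a collision. *)
Definition collision (k M : nat) (tab : nat -> CC) : Prop :=
  exists p, [/\ reached k M tab p, overlapn k tab p.1 p.2 <> 0 &
    (p.1 %% M = p.2 %% M)%N].

(** * Invariants of the graph search *)

(** The effect of a batch of pushes. By [ext_size] marks and stack grow equally, so the number of
    unmarked pairs plus the stack height is preserved. *)
Record extends (Q : node -> Prop) (st st' : seq node * seq node) : Prop := Extends {
  ext_uniq : uniq st.1 -> uniq st'.1;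
  ext_sub1 : {subset st.1 <= st'.1};
  ext_new : forall p, p \in st'.1 -> p \in st.1 \/ (p \in st'.2 /\ Q p);
  ext_sub2 : {subset st.2 <= st'.2};
  ext_stack : forall p, p \in st'.2 -> p \in st.2 \/ p \in st'.1;
  ext_size : (size st'.1 + size st.2 = size st.1 + size st'.2)%N }.

Lemma extends_refl Q st : extends Q st st.
Proof. by split=> // p; left. Qed.

Lemma extends_trans Q st1 st2 st3 :
  extends Q st1 st2 -> extends Q st2 st3 -> extends Q st1 st3.
Proof.
move=> e1 e2; split.
- by move/(ext_uniq e1)/(ext_uniq e2).
- by move=> p /(ext_sub1 e1)/(ext_sub1 e2).
- move=> p /(ext_new e2) [/(ext_new e1)[|[h1 h2]]|]; [by left| |by right].
  by right; split=> //; exact: (ext_sub2 e2).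
- by move=> p /(ext_sub2 e1)/(ext_sub2 e2).
- move=> p /(ext_stack e2) [/(ext_stack e1)[|h]|]; [by left| |by right].
  by right; exact: (ext_sub1 e2).
- by have := ext_size e1; have := ext_size e2; lia.
Qed.

Lemma extends_push (Q : node -> Prop) st p :
  (p.1 <> p.2 -> Q p) -> extends Q st (push st p).
Proof.
rewrite /push => hQ; case: eqP => /= [_|ne]; first exact: extends_refl.
case: (boolP (p \in st.1)) => hp; first exact: extends_refl.
split=> /=.
- by rewrite rcons_uniq hp.
- by move=> x hx; rewrite mem_rcons inE hx orbT.
- move=> x; rewrite mem_rcons inE => /orP[/eqP->|]; [right|by left].
  by rewrite mem_rcons inE eqxx; split=> //; exact: hQ.
- by move=> x hx; rewrite mem_rcons inE hx orbT.
- move=> x; rewrite mem_rcons inE => /orP[/eqP->|]; [right|by left].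
  by rewrite mem_rcons inE eqxx.
- by rewrite !size_rcons; lia.
Qed.

Lemma mem_push st p : p.1 <> p.2 -> p \in (push st p).1.
Proof.
rewrite /push => /eqP/negbTE ->; case: (boolP (p \in st.1)) => //= _.
by rewrite mem_rcons inE eqxx.
Qed.

Definition child_of (k m m' : nat) (p : node) : Prop := exists x y,
  [/\ (x < k)%N, (y < k)%N, p = (m * k + x, m' * k + y)%N & p.1 <> p.2].

Lemma extends_push_row k m m' x n st : (x < k)%N -> (n <= k)%N ->
  extends (child_of k m m') st (push_row k m m' x n st).
Proof.
move=> hx; elim: n => [|n IH] hn; first exact: extends_refl.
apply: extends_trans (IH (ltnW hn)) _; apply: extends_push => ne.
by exists x, n.
Qed.

Lemma mem_push_row k m m' x n st y : (x < k)%N -> (n <= k)%N -> (y < n)%N ->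
  (m * k + x <> m' * k + y)%N ->
  (m * k + x, m' * k + y)%N \in (push_row k m m' x n st).1.
Proof.
move=> hx; elim: n => // n IH hn; rewrite ltnS leq_eqVlt => /orP[/eqP->|hy] ne.
  exact: mem_push.
apply: (ext_sub1 (Q := fun _ => True) (extends_push _ _)) => //.
exact: IH (ltnW hn) hy ne.
Qed.

Lemma extends_push_rows k m m' n st : (n <= k)%N ->
  extends (child_of k m m') st (push_rows k m m' n st).
Proof.
elim: n => [|n IH] hn; first exact: extends_refl.
exact: extends_trans (IH (ltnW hn)) (extends_push_row _ _ _ hn (leqnn _)).
Qed.

Lemma mem_push_rows k m m' n st x y : (n <= k)%N -> (x < n)%N -> (y < k)%N ->
  (m * k + x <> m' * k + y)%N ->
  (m * k + x, m' * k + y)%N \in (push_rows k m m' n st).1.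
Proof.
elim: n => // n IH hn; rewrite ltnS leq_eqVlt => /orP[/eqP->|hx] hy ne.
  exact: mem_push_row.
apply: (ext_sub1 (extends_push_row _ _ _ hn (leqnn _))).
exact: IH (ltnW hn) hx hy ne.
Qed.

(** A pair with overlap zero is vacuously expanded, since walks end there; a final pair with nonzero
    overlap never is, which is how a completed search rules out collisions. *)
Definition expanded k M tab (V : seq node) (p : node) : Prop :=
  overlapn k tab p.1 p.2 <> 0 -> (p.1 %% M <> p.2 %% M)%N /\
  forall x y, (x < k)%N -> (y < k)%N ->
    ((p.1 %% M) * k + x, (p.2 %% M) * k + y)%N \in V.

Lemma expanded_sub k M tab V V' p : {subset V <= V'} ->
  expanded k M tab V p -> expanded k M tab V' p.
Proof.
by move=> hV he /he [h1 h2]; split=> // x y hx hy; apply: hV; exact: h2.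
Qed.

Definition legal k M tab (p : node) : Prop :=
  [/\ reached k M tab p, (p.1 < k * M)%N, (p.2 < k * M)%N & p.1 <> p.2].

Record sound k M tab (st : seq node * seq node) : Prop := Sound {
  sound_uniq : uniq st.1;
  sound_legal : forall p, p \in st.1 -> legal k M tab p;
  sound_sub : {subset st.2 <= st.1} }.

Definition closed_nodes k M tab (st : seq node * seq node) : Prop :=
  forall p, p \in st.1 -> p \in st.2 \/ expanded k M tab st.1 p.

Definition seeded k (U : nat) (V : seq node) : Prop :=
  forall u x y, (u < U)%N -> (x < k)%N -> (y < k)%N -> x <> y ->
    (u * k + x, u * k + y)%N \in V.

Lemma sound_extends k M tab Q st st' : sound k M tab st -> extends Q st st' ->
  (forall p, Q p -> legal k M tab p) -> sound k M tab st'.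
Proof.
move=> [hu hl hs] e hQ; split; first exact: ext_uniq e hu.
  by move=> p /(ext_new e) [/hl|[_ /hQ]].
by move=> p /(ext_stack e) [/hs/(ext_sub1 e)|].
Qed.

Lemma closed_extends k M tab Q st st' : closed_nodes k M tab st -> extends Q st st' ->
  closed_nodes k M tab st'.
Proof.
move=> hc e p /(ext_new e) [/hc [/(ext_sub2 e)|h]|[h _]]; [by left| |by left].
by right; apply: expanded_sub h; exact: ext_sub1 e.
Qed.

(** The marks are distinct pairs of numbers below [k * M]. This keeps the truncated subtraction in
    the loop variant exact. *)
Lemma sound_size k M tab st : sound k M tab st -> (size st.1 <= (k * M) ^ 2)%N.
Proof.
move=> [hu hl _].
have -> : ((k * M) ^ 2 = size [seq (a, b) | a <- iota 0 (k * M), b <- iota 0 (k * M)])%N.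
  by rewrite size_allpairs size_iota -mulnn.
apply: uniq_leq_size => // -[a b] /hl [_ ha hb _].
by apply/allpairsP; exists (a, b); rewrite !mem_iota !add0n.
Qed.

(** With nothing left to process, induction along the walk puts every reached pair into [V], where
    all pairs are expanded. *)
Lemma closed_no_collision k M tab V : closed_nodes k M tab (V, [::]) -> seeded k M V ->
  ~ collision k M tab.
Proof.
move=> hc hs [p [hr hp hM]].
have : p \in V.
  elim: hr => [u x y hu hx hy ne|p' x y _ hp' ho hne hx hy]; first exact: hs.
  by have [//|/(_ ho) [_ h]] := hc _ hp'; exact: h.
by move=> /hc [//|/(_ hp) []].
Qed.

(** * One round of the search loop *)

Lemma represents_unstack k M tab V stk p d :
  represents k M tab (V, rcons stk p) d ->
  runs 4 (Block [:: ZSub 8 8 5; ZLoad 12 8; ZSub 8 8 5; ZLoad 11 8]) d (fun d' =>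
    represents k M tab (V, stk) d' /\
    [/\ rg d' 11 = p.1, rg d' 12 = p.2 & rg d' 9 = rg d 9]).
Proof.
case: d => r m c [] /= r0 r4 r5 r6 r7 r29 r8 hmark hstk htab.
apply: runs_block => //; crunch.
have [] := hstk (size stk); first by rewrite size_rcons.
rewrite nth_rcons ltnn eqxx => <- <-.
rewrite size_rcons in r8; have e1 : r 8%N - r 5%N = (size stk).*2.+1 by lia.
have e2 : r 8%N - r 5%N - r 5%N = (size stk).*2 by lia.
rewrite e2 e1; split=> //; split=> //= i hi.
have [] := hstk i; first by rewrite size_rcons ltnS ltnW.
by rewrite nth_rcons hi.
Qed.

Lemma leq_self_sqr k : (0 < k)%N -> (k <= k ^ 2)%N.
Proof. by move=> k0; rewrite -mulnn leq_pmulr. Qed.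

Lemma visit_children_runs' k M tab st d (m m' : nat) : (0 < k)%N ->
  represents k M tab st d -> rg d 13 = m -> rg d 14 = m' -> (m < M)%N -> (m' < M)%N ->
  runs (28 * k ^ 2) visit_children d (fun d' =>
    represents k M tab (push_rows k m m' k st) d' /\
    forall x, x \in [:: 9; 10; 1] -> rg d' x = rg d x).
Proof.
move=> k0 hrep h13 h14 hm hm'.
have h := visit_children_runs hrep h13 h14 hm hm'.
apply: runs_weaken (runs_frame h) _ _; first by have := leq_self_sqr k0; nia.
move=> d' [hr hfr]; split=> // x; rewrite !inE => hx; apply: hfr.
by case/or3P: hx => /eqP->.
Qed.

Lemma expand_runs k M tab st d (w w' : nat) : (0 < k)%N -> (0 < M)%N ->
  (w < k * M)%N -> (w' < k * M)%N ->
  represents k M tab st d -> rg d 11 = w -> rg d 12 = w' -> rg d 9 = 0 ->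
  runs (44 * k ^ 2) expand d (fun d' =>
    ((w %% M = w' %% M)%N /\ represents k M tab (st.1, [::]) d' /\ rg d' 9 = 1) \/
    ((w %% M <> w' %% M)%N /\
      represents k M tab (push_rows k (w %% M) (w' %% M) k st) d' /\ rg d' 9 = 0)).
Proof.
move=> k0 M0 hw hw' hrep h11 h12 h9.
apply: (@runs_weaken (2 + ((3 * k).+1 + ((3 * k).+1 + (2 + (3 + (28 * k ^ 2).+1)))))%N) _ _; [|by have := leq_self_sqr k0; nia|by move=> d'; exact].
apply: (@runs_seq _ _ _ _ _ _ (fun d' => represents k M tab st d' /\
  [/\ rg d' 13 = w, rg d' 14 = w' & rg d' 9 = 0])).
  apply: runs_block => //.
  by case: d hrep h11 h12 h9 => r m c [] *; simpl in *; crunch; split=> //; split=> //; lia.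
move=> {h11 h12 h9 hrep} d [hr [h13 h14 h9]].
apply: (@runs_seq _ _ _ _ _ _ (fun d' => represents k M tab st d' /\
  [/\ rg d' 13 = (w %% M)%N, rg d' 14 = w' & rg d' 9 = 0])).
  apply: runs_weaken (runs_frame (reduce_runs _ M0 hw hr h13)) (leqnn _) _ => //.
  by move=> d' [[hr' h'] fr]; split=> //; rewrite (fr 14%N) // (fr 9%N).
move=> {h13 h14 h9 hr} d [hr [h13 h14 h9]].
apply: (@runs_seq _ _ _ _ _ _ (fun d' => represents k M tab st d' /\
  [/\ rg d' 13 = (w %% M)%N, rg d' 14 = (w' %% M)%N & rg d' 9 = 0])).
  apply: runs_weaken (runs_frame (reduce_runs _ M0 hw' hr h14)) (leqnn _) _ => //.
  by move=> d' [[hr' h'] fr]; split=> //; rewrite (fr 13%N) // (fr 9%N).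
move=> {h13 h14 h9 hr} d [hr [h13 h14 h9]].
have hm : (w %% M < M)%N by rewrite ltn_mod.
have hm' : (w' %% M < M)%N by rewrite ltn_mod.
move: (w %% M)%N (w' %% M)%N hm hm' h13 h14 => m m' hm hm' h13 h14.
apply: (@runs_seq _ _ _ _ _ _ (fun d' => represents k M tab st d' /\
  [/\ rg d' 13 = m, rg d' 14 = m', rg d' 9 = 0 & rg d' 32 = (m%:Z - m'%:Z) ^+ 2])).
  apply: runs_block => //.
  case: d hr h13 h14 h9 => r mm c [] *; simpl in *; crunch; split=> //; split=> //.
  by rewrite expr2; congr (_ * _); lia.
move=> {h13 h14 h9 hr} d [hr [h13 h14 h9 h32]].
(* There is no else-branch: both conditionals test register 32, so the state between them records
   which case holds. *)
apply: (@runs_seq _ _ _ _ _ _ (fun d' =>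
  (m = m' /\ represents k M tab (st.1, [::]) d' /\ rg d' 9 = 1 /\ rg d' 32 = 0) \/
  (m <> m' /\ represents k M tab st d' /\ rg d' 9 = 0 /\
    [/\ rg d' 13 = m, rg d' 14 = m' & 0 < rg d' 32]))).
  apply: runs_unless; rewrite h32 (rep_1 hr) => hle.
    by right; split; [nia|split=> //; split=> //; split=> //; nia].
  have e : m = m' by nia.
  apply: runs_block => //; left; split=> //.
  rewrite e subrr expr0n /= in h32.
  by case: d hr h32 {h13 h14 h9 hle} => r mm c [] *; simpl in *; crunch; split.
move=> d' [[e [hr' [h9' h32']]]|[ne [hr' [h9' [h13' h14' h32']]]]].
  apply: runs_unless; rewrite h32' (rep_0 hr'); last by rewrite ltxx.
  by left.
apply: runs_unless; rewrite (rep_0 hr'); first by rewrite leNgt h32'.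
move=> _; have h := visit_children_runs' k0 hr' h13' h14' hm hm'.
apply: runs_weaken h (leqnn _) _ => d'' [hr'' fr]; right; split=> //; split=> //.
by rewrite fr.
Qed.

Lemma process_runs k M tab V stk p d : (0 < k)%N -> (0 < M)%N ->
  (p.1 < k * M)%N -> (p.2 < k * M)%N ->
  represents k M tab (V, rcons stk p) d -> rg d 9 = 0 ->
  runs (66 * k ^ 2) process d (fun d' =>
    [\/ [/\ overlapn k tab p.1 p.2 <> 0, (p.1 %% M = p.2 %% M)%N,
           represents k M tab (V, [::]) d' & rg d' 9 = 1],
        [/\ overlapn k tab p.1 p.2 <> 0, (p.1 %% M <> p.2 %% M)%N,
           represents k M tab (push_rows k (p.1 %% M) (p.2 %% M) k (V, stk)) d'
         & rg d' 9 = 0] |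
        [/\ overlapn k tab p.1 p.2 = 0, represents k M tab (V, stk) d' & rg d' 9 = 0]]).
Proof.
move=> k0 M0 hp1 hp2 hrep h9.
apply: (@runs_weaken (4 + ((8 * k + 9) + (44 * k ^ 2).+1))%N) _ _; [|by have := leq_self_sqr k0; nia|by move=> d'; exact].
apply: runs_seq (represents_unstack hrep) _ => d1 [hr1 [h11 h12 h91]].
rewrite h9 in h91.
apply: runs_seq (runs_frame (overlap_runs hr1 h11 h12)) _ => d2 [[hr2 [ho hz]] fr].
have h92 : rg d2 9 = 0 by rewrite fr.
have h112 : rg d2 11 = p.1 by rewrite fr.
have h122 : rg d2 12 = p.2 by rewrite fr.
apply: runs_unlessC; rewrite ho hz => hov; first by apply: Or33.
have h := expand_runs k0 M0 hp1 hp2 hr2 h112 h122 h92.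
apply: runs_weaken h (leqnn _) _ => d3 [[e [hr3 h93]]|[e [hr3 h93]]].
  by apply: Or31.
by apply: Or32.
Qed.

(* The index [a], which bounds the remaining iterations, is the number of unmarked
   pairs plus the height of the stack: each pair is pushed at most once. *)
Definition loop_state k M tab (a : nat) (d : store) : Prop := exists V stk,
  [/\ represents k M tab (V, stk) d, sound k M tab (V, stk),
      a = ((k * M) ^ 2 - size V + size stk)%N &
      (rg d 9 = 1 /\ stk = [::] /\ collision k M tab) \/
      (rg d 9 = 0 /\ closed_nodes k M tab (V, stk) /\ seeded k M V)].

Lemma legal_child k M tab m m' p q : (m < M)%N -> (m' < M)%N ->
  reached k M tab q -> overlapn k tab q.1 q.2 <> 0 -> (q.1 %% M <> q.2 %% M)%N ->
  m = (q.1 %% M)%N -> m' = (q.2 %% M)%N ->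
  child_of k m m' p -> legal k M tab p.
Proof.
move=> hm hm' hq ho hne em em' [x [y [hx hy ep ne]]]; split=> //; rewrite ep.
- by rewrite em em'; apply: ReachedChild.
- exact: child_bound.
- exact: child_bound.
Qed.

Lemma process_step k M tab a d : (0 < k)%N -> (0 < M)%N -> loop_state k M tab a d ->
  0 < rg d 8 ->
  exists2 b, a = b.+1 & runs (66 * k ^ 2) process d
    (fun d' => exists2 b', (b' <= b)%N & loop_state k M tab b' d').
Proof.
move=> k0 M0 [V [stk [hr hs ea hc]]]; rewrite (rep_size hr) /=.
case/lastP: stk hr hs ea hc => [//|stk p] hr hs ea hc _.
case: hc => [[_ [e]]|[h9 [hc hseed]]]; first by case: stk {hr hs ea} e.
have pV : p \in V by apply: (sound_sub hs); rewrite mem_rcons inE eqxx.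
have [hrp hp1 hp2 hne] := sound_legal hs pV.
(* Popping lowers the variant by one; the pushes that follow keep it constant. *)
exists ((k * M) ^ 2 - size V + size stk)%N; first by rewrite ea size_rcons; lia.
have hs0 : sound k M tab (V, stk).
  split; [exact: sound_uniq hs|exact: sound_legal hs|].
  by move=> x hx; apply: (sound_sub hs); rewrite mem_rcons inE hx orbT.
have hV := sound_size hs0; rewrite /= in hV.
apply: runs_weaken (process_runs k0 M0 hp1 hp2 hr h9) (leqnn _) _.
move=> d' [] [ho].
- move=> em hr' h9'; exists ((k * M) ^ 2 - size V)%N; first by lia.
  exists V, [::]; split=> //; first by split; [exact: sound_uniq hs|exact: sound_legal hs|].
    by rewrite addn0.
  by left; split=> //; split=> //; exists p.
- move=> em hr' h9'.
  have ext : extends _ (V, stk) _ :=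
    extends_push_rows (p.1 %% M)%N (p.2 %% M)%N (V, stk) (leqnn k).
  have hm : (p.1 %% M < M)%N by rewrite ltn_mod.
  have hm' : (p.2 %% M < M)%N by rewrite ltn_mod.
  have hmem x y : (x < k)%N -> (y < k)%N ->
      ((p.1 %% M) * k + x, (p.2 %% M) * k + y)%N \in
      (push_rows k (p.1 %% M) (p.2 %% M) k (V, stk)).1.
    (* The residues differ, so no successor lies on the diagonal, and [push] skips only pairs that
       are marked already. *)
    move=> hx hy; apply: mem_push_rows => // e.
    by have [] := pair_code_inj hx hy e.
  move: (push_rows _ _ _ _ _) hr' ext hmem => [V' stk'] hr' ext hmem.
  have hs' : sound k M tab (V', stk').
    by apply: sound_extends hs0 ext _ => q; apply: legal_child em erefl erefl.
  have hV' := sound_size hs'; have es := ext_size ext; rewrite /= in hV' es hmem.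
  exists ((k * M) ^ 2 - size V' + size stk')%N; first by lia.
  exists V', stk'; split=> //; right; split=> //; split; last first.
    by move=> u x y hu hx hy hxy; apply: (ext_sub1 ext); exact: hseed.
  move=> q /(ext_new ext) /= [hq|[hq _]]; last by left.
  have [|he] := hc _ hq.
    rewrite mem_rcons inE => /orP[/eqP ->|hq']; last by left; apply: (ext_sub2 ext).
    by right.
  by right; apply: expanded_sub he; exact: (ext_sub1 ext).
- move=> hr' h9'; exists ((k * M) ^ 2 - size V + size stk)%N => //.
  exists V, stk; split=> //; right; split=> //; split=> // q hq.
  have [|he] := hc _ hq; last by right.
  rewrite mem_rcons inE => /orP[/eqP ->|hq']; last by left.
  by right.
Qed.

Lemma main_loop_runs k M tab a d : (0 < k)%N -> (0 < M)%N -> loop_state k M tab a d ->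
  runs (a * (66 * k ^ 2).+2).+1 (UntilLe 8 4 process) d (fun d' =>
    exists st, represents k M tab st d' /\
    ((rg d' 9 = 1 /\ collision k M tab) \/ (rg d' 9 = 0 /\ ~ collision k M tab))).
Proof.
move=> k0 M0 hl.
have h := @runs_until (loop_state k M tab) (66 * k ^ 2) 8 4 process a d _ hl.
apply: runs_weaken (h _) (leqnn _) _ => [b d' hl'|d' [hle [b [V [stk [hr hs _ hc]]]]]].
  case: leP => // hlt; apply: process_step => //.
  by case: hl' hlt => V [stk [hr _ _ _]]; rewrite (rep_0 hr).
exists (V, stk); split=> //; case: hc => [[h9 [_ hcol]]|[h9 [hc hseed]]]; first by left.
right; split=> //; apply: closed_no_collision hseed.
move: hle; rewrite (rep_size hr) (rep_0 hr) /=; case: stk {hr hs} hc => //= x s hc; lia.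
Qed.

(** * Seeding, initialization and the total cost *)

(** Nothing is popped while seeding, so marks and stack have equal size and the variant of the main
    loop starts at exactly [(k * M) ^ 2]. *)
Definition seed_state k M tab (u : nat) (d : store) : Prop := exists V stk,
  [/\ represents k M tab (V, stk) d, sound k M tab (V, stk),
      closed_nodes k M tab (V, stk) & seeded k u V] /\
  [/\ rg d 9 = 0, rg d 10 = u & size V = size stk].

Lemma seed_step k M tab u d : (0 < k)%N -> (u < M)%N -> seed_state k M tab u d ->
  runs (2 + (28 * k ^ 2 + 1))
    (Seq (Block [:: ZAdd 13 10 4; ZAdd 14 10 4])
    (Seq visit_children (Block [:: ZAdd 10 10 5]))) d (seed_state k M tab u.+1).
Proof.
move=> k0 hu [V [stk [[hr hs hc hseed] [h9 h10 hsz]]]].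
apply: (@runs_seq _ _ _ _ _ _ (fun d' => represents k M tab (V, stk) d' /\
  [/\ rg d' 13 = u, rg d' 14 = u, rg d' 9 = 0 & rg d' 10 = u])).
  apply: runs_block => //.
  by case: d hr h9 h10 => r m c [] *; simpl in *; crunch; split=> //; split=> //; lia.
move=> {h9 h10 hr} d [hr [h13 h14 h9 h10]].
apply: runs_seq (visit_children_runs' k0 hr h13 h14 hu hu) _ => d' [hr' fr].
have h9' : rg d' 9 = 0 by rewrite fr.
have h10' : rg d' 10 = u by rewrite fr.
apply: runs_block => //.
have ext : extends _ (V, stk) _ := extends_push_rows u u (V, stk) (leqnn k).
have hmem x y : (x < k)%N -> (y < k)%N -> x <> y ->
    (u * k + x, u * k + y)%N \in (push_rows k u u k (V, stk)).1.
  by move=> hx hy ne; apply: mem_push_rows => // /addnI.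
move: (push_rows _ _ _ _ _) hr' ext hmem => [V' stk'] hr' ext hmem.
exists V', stk'; split; last first.
  have esz : size V' = size stk' by have := ext_size ext; rewrite /=; lia.
  by case: d' hr' h9' h10' {fr} => r m c [] *; simpl in *; crunch; split=> //; lia.
split.
- by case: d' hr' h9' h10' {fr} => r m c [] *; simpl in *; crunch; split.
- apply: sound_extends hs ext _ => p [x [y [hx hy ep ne]]]; rewrite ep; split.
  + by apply: ReachedSeed => // exy; rewrite ep exy in ne.
  + exact: child_bound.
  + exact: child_bound.
  + by rewrite ep in ne.
- exact: closed_extends hc ext.
- move=> v x y; rewrite ltnS leq_eqVlt => /orP[/eqP->|hv] hx hy ne; first exact: hmem.
  by apply: (ext_sub1 ext); exact: hseed.
Qed.

(** Only negative integer cells must be 0: those from 0 on hold [N] at the start and are overwritten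
    by the stack. *)
Record initialized (k r : nat) (tab : nat -> CC) (d : store) : Prop := Initialized {
  ini_k : rg d 0 = k;
  ini_r : rg d 1 = r;
  ini_0 : rg d 4 = 0;
  ini_1 : rg d 5 = 1;
  ini_sp : rg d 8 = 0;
  ini_found : rg d 9 = 0;
  ini_im : forall a : nat, im d (-1 - a%:Z) = 0;
  ini_tab : forall a : nat, xm d a = tab a }.

Lemma power_runs k r tab d : (0 < r)%N -> initialized k r tab d ->
  rg d 6 = 1 -> rg d 30 = 1 ->
  runs (r.-1 * 4).+1 (UntilLe 1 30 (Block [:: ZMul 6 6 0; ZAdd 30 30 5])) d
    (fun d' => initialized k r tab d' /\ rg d' 6 = (k ^ r.-1)%N).
Proof.
move=> r0 hi h6 h30.
pose I a d' := initialized k r tab d' /\ rg d' 6 = (k ^ a)%N /\ rg d' 30 = a.+1.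
apply: (@runs_weaken _ _ _ _ (I r.-1)) (leqnn _) _; last by move=> d' [? []].
apply: runs_for => [a d' ha [hd [_ ->]]|a d' ha [hd [h6' h30']]|//].
  by rewrite (ini_r hd); apply/idP/eqP; lia.
apply: runs_block => //.
case: d' hd h6' h30' => rr m c [] /= r00 r1 r4 r5 r8 r9 hm htab h6' h30'.
crunch; split=> //; split=> /=; last by lia.
by rewrite h6' r00 expnSr PoszM.
Qed.

Lemma search_runs k r tab d : (1 < k)%N -> (0 < r)%N -> initialized k r tab d ->
  runs (150 * (k ^ r.+1) ^ 2) search d (fun d' =>
    rg d' 0 = 1 <-> ~ collision k (k ^ r.-1) tab).
Proof.
move=> k1 r0 hi; have k0 : (0 < k)%N by lia.
set M := (k ^ r.-1)%N; have M0 : (0 < M)%N by rewrite expn_gt0 k0.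
(* The dominant term is [66 * k ^ 2] for each of [(k * M) ^ 2] pairs, and [k ^ 2 * (k * M) ^ 2]
   equals [(k ^ r.+1) ^ 2]. *)
apply: (@runs_weaken (2 + ((r.-1 * 4).+1 + (3 + ((M * (2 + (28 * k ^ 2 + 1)).+2).+1 +
   (((k * M) ^ 2 * (66 * k ^ 2).+2).+1 + 1)))))%N) _ _; last 1 first.
- by move=> d'; exact.
- apply: (@runs_seq _ _ _ _ _ _ (fun d' => initialized k r tab d' /\ rg d' 6 = 1 /\ rg d' 30 = 1)).
    by apply: runs_block => //; case: d hi => rr m c [] *; simpl in *; crunch.
  move=> {hi} d [hi [h6 h30]].
  apply: runs_seq (power_runs r0 hi h6 h30) _ => {hi h6 h30} d [hi h6].
  apply: (@runs_seq _ _ _ _ _ _ (seed_state k M tab 0)).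
    apply: runs_block => //; exists [::], [::]; split.
      split=> //.
      case: d hi h6 => rr m c [] /= r00 *; simpl in *; crunch; split=> //=.
      - by rewrite r00; lia.
      - by lia.
    by case: d hi h6 => rr m c [] *; simpl in *; crunch.
  move=> {hi h6} d hd.
  apply: (@runs_seq _ _ _ _ _ _ (seed_state k M tab M)).
    apply: runs_for hd => [u d' hu|u d' hu]; last exact: seed_step.
    move=> [V [stk [[hr _ _ _] [_ h10 _]]]]; rewrite h10 (rep_M hr).
    by apply/idP/eqP; lia.
  move=> {hd} d [V [stk [[hr hs hc hseed] [h9 h10 hsz]]]].
  have hV := sound_size hs; rewrite /= in hV.
  have hl : loop_state k M tab ((k * M) ^ 2) d.
    by exists V, stk; split=> //; [lia|right].
  apply: runs_seq (main_loop_runs k0 M0 hl) _ => d' [st [hr' hcol]].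
  apply: runs_block => //.
  case: d' hr' hcol => rr m c [] /= r00 r4 r5 r6 r7 r29 r8 hm hstk htab hcol; crunch.
  rewrite r5; case: hcol => -[-> hcol]; by split.
- have er : (k ^ r.+1 = k ^ 2 * M)%N by rewrite -expnD; congr (_ ^ _)%N; lia.
  (* Here [k > 1] enters: [r <= k ^ r] pays for the [r - 1] multiplications that compute [M]. *)
  have rM : (r <= k * M)%N by rewrite -expnS prednK //; exact: ltnW (ltn_expl _ k1).
  rewrite er; have := leq_self_sqr k0.
  have e1 : ((k ^ 2 * M) ^ 2 = k ^ 2 * (k * M) ^ 2)%N by ring.
  have h1 : (k * M <= (k * M) ^ 2)%N by apply: leq_self_sqr; rewrite muln_gt0 k0.
  have h2 : (M <= (k * M) ^ 2)%N by apply: leq_trans h1; rewrite leq_pmull.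
  have K1 : (0 < k ^ 2)%N by rewrite expn_gt0 k0.
  rewrite e1; move: ((k * M) ^ 2)%N (k ^ 2)%N h1 h2 K1 => Z K h1 h2 K1 _.
  have h3 : (Z <= K * Z)%N by rewrite leq_pmull.
  have h4 : (M * K <= K * Z)%N by rewrite mulnC leq_mul2l h2 orbT.
  nia.
Qed.

Lemma decide_runs k r tab R m c : (0 < k)%N -> (0 < r)%N ->
  initialized k r tab (Store (updn R 5 1) m c) ->
  runs (155 * (k ^ r.+1) ^ 2) decide (Store R m c) (fun d' =>
    rg d' 0 = 1 <-> ~ collision k (k ^ r.-1) tab).
Proof.
move=> k0 r0 hi.
have n1 : (0 < (k ^ r.+1) ^ 2)%N by rewrite !expn_gt0 k0.
apply: (@runs_weaken (1 + (150 * (k ^ r.+1) ^ 2).+1)%N) _ _; [|by lia|by move=> d'; exact].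
apply: (@runs_seq _ _ _ _ _ _ (fun d => d = Store (updn R 5 1) m c)).
  by apply: runs_block; rewrite //= effectE.
move=> _ ->; apply: runs_unless; rewrite (ini_k hi) (ini_1 hi) => hk.
  have e : k = 1 by lia.
  (* With one state no pair is reached: a seed needs two distinct letters, and modulo [M = 1] all
     residues agree. *)
  rewrite e; split=> // _ [p [hp _ _]].
  case: p / hp => [u x y _ hx hy ne|p x y hp _ ne hx hy]; first by case: ne; lia.
  by case: ne; rewrite exp1n !modn1.
by apply: search_runs.
Qed.

Lemma decide_correct (k r : nat) (tab : nat -> CC) (R : nat -> int) m c :
  (0 < k)%N -> (0 < r)%N -> initialized k r tab (Store (updn R 5 1) m c) ->
  exists s', run (compile 0 decide) (156 * (k ^ r.+1) ^ 2)%N (MState 0 R m c) = Some s' /\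
    (zr s' 0 = 1 <-> ~ collision k (k ^ r.-1) tab).
Proof.
move=> k0 r0 hi; have [t [d' [ht hx hQ]]] := decide_runs k0 r0 hi.
exists (at_pc (csize decide) d'); split=> //.
apply: (compile_run hx); apply: leq_ltn_trans ht _.
by rewrite ltn_pmul2r // !expn_gt0 k0.
Qed.

(** * Inner products of columns *)

Lemma fsbig_injective (R : Type) (idx : R) (op : Monoid.com_law idx) (I : finType)
    (J : choiceType) (h : I -> J) (A : set J) (F : J -> R) :
  injective h -> (forall i, A (h i)) ->
  (forall j, A j -> (forall i, h i <> j) -> F j = idx) ->
  \big[op/idx]_(j \in A) F j = \big[op/idx]_(i : I) F (h i).
Proof.
move=> hinj hA hF; rewrite (@fsbigE _ _ _ _ _ [seq h i | i <- enum I]).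
- rewrite big_map big_enum_cond; apply: eq_bigl => i.
  by rewrite mem_set.
- by rewrite map_inj_uniq // enum_uniq.
- by move=> j /= /mapP[i _ ->].
- move=> j hj hn; apply: hF => // i e; case/negP: hn.
  by apply/mapP; exists i; rewrite ?mem_enum.
Qed.

Section Factor.
Local Open Scope classical_set_scope.
Variables (S : finType) (q : S) (n : nat) (B : int).
Let pos (j : 'I_n) : int := j%:Z + B.

Let pos_inj : injective pos.
Proof. by move=> i j /addIr [] /val_inj. Qed.

Lemma prod_window (F : int -> CC) : (forall i, (forall j, pos j <> i) -> F i = 1) ->
  \big[*%R/1]_(i \in [set: int]) F i = \prod_(j < n) F (pos j).
Proof. by move=> hF; apply: fsbig_injective => // i _; exact: hF. Qed.

Definition fill (phi : {ffun 'I_n -> S}) (i : int) : S :=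
  if [pick j | pos j == i] is Some j then phi j else q.

Lemma fill_pos phi j : fill phi (pos j) = phi j.
Proof.
rewrite /fill; case: pickP => [j' /eqP/pos_inj -> //|/(_ j)].
by rewrite eqxx.
Qed.

Lemma fill_out phi i : (forall j, pos j <> i) -> fill phi i = q.
Proof. by move=> h; rewrite /fill; case: pickP => // j /eqP /h. Qed.

Lemma fill_inj : injective fill.
Proof.
move=> f g e; apply/ffunP => j.
by rewrite -(fill_pos f) -(fill_pos g) e.
Qed.

Lemma finite_window : finite_set [set i | exists j, pos j = i].
Proof.
have -> : [set i | exists j, pos j = i] = [set` [seq pos j | j <- enum 'I_n]].
  apply/seteqP; split => i /=; first by move=> [j <-]; apply: map_f; rewrite mem_enum.
  by case/mapP => j _ ->; exists j.
exact: finite_seq.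
Qed.

(** Distributivity: a configuration that differs from [q] outside the window contributes 0, and the
    others are the functions from the window to [S], over which a sum of products is a product of
    sums. *)
Lemma sum_configs_prod (C : set (int -> S)) (F G : int -> S -> CC) :
  C = [set c | finite_set [set i | c i != q]] ->
  (forall i, (forall j, pos j <> i) -> forall x, F i x = if x == q then 1 else 0) ->
  (forall i, (forall j, pos j <> i) -> forall x, G i x = if x == q then 1 else 0) ->
  \sum_(d \in C) (\big[*%R/1]_(i \in [set: int]) F i (d i)) *
     (\big[*%R/1]_(i \in [set: int]) G i (d i))^* =
  \prod_(j < n) \sum_(x : S) F (pos j) x * (G (pos j) x)^*.
Proof.
move=> eC hF hG; rewrite (fsbig_injective _ fill_inj); last first.
- move=> d; rewrite eC /= => hd hnot.
  have [i [hi hdi]] : exists i, (forall j, pos j <> i) /\ d i != q.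
    apply: contrapT => hno; apply: (hnot [ffun j => d (pos j)]).
    apply/funext => i; case: (pselect (exists j, pos j = i)) => [[j <-]|hj].
      by rewrite fill_pos ffunE.
    have hj' : forall j, pos j <> i by move=> j e; apply: hj; exists j.
    rewrite fill_out //; apply/esym/eqP; apply: contraT => hne.
    by case: hno; exists i.
  (* A product of infinite support would be 1 by convention; it is first confined to the finite set
     [D], so that the factor 0 at [i] counts. *)
  set D := [set i | d i != q] `|` [set i | exists j, pos j = i].
  have fD : finite_set D by rewrite finite_setU; split=> //; exact: finite_window.
  rewrite (_ : \big[_/_]_(i \in setT) F i (d i) = 0) ?mul0r //.
  rewrite -(@fsbig_widen _ _ _ _ D) //; last first.
    move=> a /= [_ hnD]; rewrite hF; last by move=> j e; apply: hnD; right; exists j.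
    by case: eqP => // /eqP hne; case: hnD; left.
  have Di : D i by left.
  rewrite (fsbigD1 i) //=.
  by rewrite hF // (negbTE hdi) mul0r.
- move=> phi; rewrite eC /=; apply: sub_finite_set finite_window => i /= hne.
  apply: contrapT => hj; case/negP: hne; apply/eqP/fill_out => j e.
  by apply: hj; exists j.
rewrite bigA_distr_bigA /=; apply: eq_bigr => phi _.
rewrite prod_window; last by move=> i hi; rewrite hF // fill_out // eqxx.
rewrite prod_window; last by move=> i hi; rewrite hG // fill_out // eqxx.
rewrite rmorph_prod -big_split /=; apply: eq_bigr => j _.
by rewrite fill_pos.
Qed.
End Factor.

(** * Neighbourhoods and inner products for simple automata *)

Definition window (S : finType) (r : nat) (c : int -> S) (i : int) : r.-tuple S :=
  [tuple c (i + j%:Z) | j < r].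

Definition overlapw (S : finType) (A : lqca S) (w w' : (lq_r A).-tuple S) : CC :=
  \sum_x lq_delta A w x * (lq_delta A w' x)^*.

(** Strict growth bounds each entry from below when counting up from the first entry, and from above
    when counting down from the last; simplicity makes the two bounds meet. *)
Lemma simple_tnth (S : finType) (A : lqca S) : is_lqca A -> simple_lqca A ->
  forall j : 'I_(lq_r A), tnth (lq_N A) j = nth 0 (lq_N A) 0 + j%:Z.
Proof.
case: A => q r N delta [hinc _] [/= r0 hs] j; rewrite /= in hinc j *.
have e (i : 'I_r) : nth 0 N i = tnth N i by rewrite (tnth_nth 0).
have hlo m : (m < r)%N -> nth 0 N 0 + m%:Z <= nth 0 N m.
  elim: m => [|m IH] hm; first by rewrite addr0.
  have := hinc (Ordinal (ltnW hm)) (Ordinal hm) (ltnSn m).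
  rewrite -!e /= -lezD1; apply: le_trans.
  by rewrite -addn1 PoszD addrA lerD2r; exact: IH (ltnW hm).
have hhi m : (m < r)%N -> nth 0 N (r.-1 - m)%N + m%:Z <= nth 0 N r.-1.
  elim: m => [|m IH] hm; first by rewrite subn0 addr0.
  have h1 : (r.-1 - m.+1 < r)%N by lia.
  have h2 : (r.-1 - m < r)%N by lia.
  have h3 : (r.-1 - m.+1 < r.-1 - m)%N by lia.
  have := hinc (Ordinal h1) (Ordinal h2) h3.
  rewrite -!e /= -lezD1 => h; apply: le_trans (IH (ltnW hm)).
  by rewrite -add1n PoszD addrA lerD2r.
have hj : (j <= r.-1)%N by have := ltn_ord j; lia.
apply/eqP; rewrite -e eq_le hlo // andbT.
rewrite -(lerD2r (r.-1 - j)%N%:Z) -addrA -PoszD subnKC // -hs.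
rewrite [nth 0 N 0 + _]addrC subrK.
have h := hhi (r.-1 - j)%N; rewrite subKn // in h; apply: h.
by rewrite (leq_ltn_trans (leq_subr _ _)) // prednK.
Qed.

Lemma nbhd_window (S : finType) (A : lqca S) c i : is_lqca A -> simple_lqca A ->
  nbhd A c i = window (lq_r A) c (i + nth 0 (lq_N A) 0).
Proof.
by move=> hA hs; apply: eq_from_tnth => j; rewrite !tnth_mktuple simple_tnth // addrA.
Qed.

Lemma configs_bounded (S : finType) (A : lqca S) c : configs A c ->
  exists b : nat, forall i : int, (b <= `|i|)%N -> c i = lq_q A.
Proof.
rewrite /configs /= => /finite_seqP [s es].
exists (\max_(i <- s) `|i|)%N.+1 => i hi; apply/eqP; apply: contraT => hne.
have : i \in s by have : [set i | c i != lq_q A]%classic i by []; rewrite es.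
  by move=> his; have := @leq_bigmax_seq _ s xpredT (fun i : int => `|i|%N) i his isT; lia.
Qed.

Lemma bounded_configs (S : finType) (A : lqca S) c (b : nat) :
  (forall i : int, (b <= `|i|)%N -> c i = lq_q A) -> configs A c.
Proof.
move=> h; rewrite /configs /=.
apply: (@sub_finite_set _ _ [set` [seq i%:Z - b%:Z | i <- iota 0 (b + b)]]%classic); last exact: finite_seq.
move=> /= i hi; have hb : (absz i < b)%N.
  by rewrite ltnNge; apply/negP => /h e; rewrite e eqxx in hi.
apply/mapP; exists (absz (i + b%:Z)); first by rewrite mem_iota; lia.
by lia.
Qed.

Lemma window_q (S : finType) (A : lqca S) c (i : int) :
  (forall j : nat, (j < lq_r A)%N -> c (i + j%:Z) = lq_q A) ->
  window (lq_r A) c i = qword A.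
Proof. by move=> h; apply: eq_from_tnth => j; rewrite !tnth_mktuple h. Qed.

(** The inner product is a product of overlaps over a finite window; outside it both neighbourhoods
    are [qword A], whose overlap with itself is 1. *)
Lemma inner_neq0 (S : finType) (A : lqca S) c c' : is_lqca A -> simple_lqca A ->
  configs A c -> configs A c' ->
  (inner A (fun d => UA A d c) (fun d => UA A d c') <> 0 <->
   forall i, overlapw (window (lq_r A) c i) (window (lq_r A) c' i) <> 0).
Proof.
move=> hA hs hc hc'.
have [b hb] := configs_bounded hc; have [b' hb'] := configs_bounded hc'.
set a := nth 0 (lq_N A) 0; have [_ [_ hq]] := hA.
(* Going [b + b' + r] cells to either side passes both supports; the shift by [a] undoes the offset
   of the neighbourhood. *)
pose n := (b + b' + lq_r A).*2.+1; pose B : int := - (b + b' + lq_r A)%N%:Z - a.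
have hout f i : (forall i : int, (b + b' <= `|i|)%N -> f i = lq_q A) ->
    (forall j : 'I_n, j%:Z + B <> i) -> nbhd A f i = qword A.
  move=> hf hi; rewrite nbhd_window //; apply: window_q => j hj; apply: hf.
  case: (ltnP (`|i - B|) n) => hn; last by rewrite /B /n -/a in hn *; lia.
  case: (leP 0 (i - B)) => h0; last by rewrite /B /n -/a in hn h0 *; lia.
  by case: (hi (Ordinal hn)); rewrite /=; lia.
have hF f i : (forall i : int, (b + b' <= `|i|)%N -> f i = lq_q A) ->
    (forall j : 'I_n, j%:Z + B <> i) -> forall x,
    lq_delta A (nbhd A f i) x = if x == lq_q A then 1 else 0.
  by move=> hf hi x; rewrite hout.
have hbc (i : int) : (b + b' <= `|i|)%N -> c i = lq_q A by move=> h; apply: hb; lia.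
have hbc' (i : int) : (b + b' <= `|i|)%N -> c' i = lq_q A by move=> h; apply: hb'; lia.
rewrite /inner /UA (@sum_configs_prod S (lq_q A) n B (configs A)
  (fun i => lq_delta A (nbhd A c i)) (fun i => lq_delta A (nbhd A c' i))) //;
  [|by move=> i; exact: hF|by move=> i; exact: hF].
split.
  move=> /eqP /prodf_neq0 h i; case: (pselect (exists j : 'I_n, j%:Z + B = i - a)) => [[j ej]|hj].
    have /eqP := h j isT; rewrite -/(overlapw _ _) !nbhd_window // -/a ej.
    by rewrite subrK.
  have hj' (j : 'I_n) : j%:Z + B <> i - a by move=> e; apply: hj; exists j.
  have := hout _ _ hbc hj'; have := hout _ _ hbc' hj'.
  rewrite !nbhd_window // -/a subrK => -> ->.
  rewrite /overlapw (bigD1 (lq_q A)) //= big1 => [|x hx].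
    by rewrite !hq eqxx addr0 mul1r conjC1; apply/eqP/oner_neq0.
  by rewrite !hq (negbTE hx) mul0r.
move=> h; apply/eqP/prodf_neq0 => j _; apply/eqP.
by have := h (j%:Z + B + a); rewrite -/(overlapw _ _) !nbhd_window.
Qed.

(** * Words as numbers in base [#|S|] *)

(** Indexed by position and length, so that shifts, prefixes and suffixes need no casts between
    tuple types. *)
Fixpoint code (S : finType) (c : int -> S) (i : int) (n : nat) : nat :=
  if n is n'.+1 then (code c i n' * #|S| + srank (c (i + n'%:Z)%R))%N else 0%N.

Lemma srank_lt (S : finType) (x : S) : (srank x < #|S|)%N.
Proof. exact: ltn_ord. Qed.

Lemma srank_inj (S : finType) : injective (@srank S).
Proof. by move=> x y /val_inj /enum_rank_inj. Qed.

Lemma srank_surj (S : finType) n : (n < #|S|)%N -> exists x : S, srank x = n.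
Proof. by move=> h; exists (enum_val (Ordinal h)); rewrite /srank enum_valK. Qed.

(** The definition splits off the last letter; here it is the first, which reduction modulo
    [#|S| ^ n] removes. *)
Lemma codeS_left (S : finType) (c : int -> S) i n :
  code c i n.+1 = (srank (c i) * #|S| ^ n + code c (i + 1) n)%N.
Proof.
elim: n => [|n IH]; first by rewrite /= addr0 expn0 muln1 addn0.
rewrite [LHS]/= -/(code c i n.+1) IH [in RHS]/= expnSr.
by rewrite -addrA -PoszD add1n; ring.
Qed.

Lemma code_lt (S : finType) (c : int -> S) i n : (code c i n < #|S| ^ n)%N.
Proof.
elim: n => [|n IH] //=; rewrite expnSr.
apply: (@leq_trans ((code c i n).+1 * #|S|)%N); last by rewrite leq_mul2r IH orbT.
by rewrite mulSn addnC ltn_add2r srank_lt.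
Qed.

Lemma code_modn (S : finType) (c : int -> S) i n :
  (code c i n.+1 %% #|S| ^ n = code c (i + 1) n)%N.
Proof. by rewrite codeS_left modnMDl modn_small // code_lt. Qed.

Lemma code_inj (S : finType) (c c' : int -> S) i n : code c i n = code c' i n ->
  forall j, (j < n)%N -> c (i + j%:Z) = c' (i + j%:Z).
Proof.
elim: n => // n IH /= e j.
have [e1 /srank_inj e2] := pair_code_inj (srank_lt _) (srank_lt _) e.
by rewrite ltnS leq_eqVlt => /orP[/eqP->|] //; exact: IH.
Qed.

Lemma eq_code (S : finType) (c c' : int -> S) i n :
  (forall j, (j < n)%N -> c (i + j%:Z) = c' (i + j%:Z)) -> code c i n = code c' i n.
Proof.
elim: n => //= n IH h; rewrite h // IH // => j hj; apply: h.
exact: ltnW.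
Qed.

Lemma code_surj (S : finType) (q : S) i n u : (u < #|S| ^ n)%N ->
  exists c : int -> S, code c i n = u.
Proof.
elim: n u => [|n IH] u hu; first by exists (fun=> q); case: u hu.
have k0 : (0 < #|S|)%N by apply/card_gt0P; exists q.
have [|c hc] := IH (u %/ #|S|)%N; first by rewrite ltn_divLR // -expnSr.
have [x hx] := @srank_surj S (u %% #|S|) (ltn_pmod _ k0).
exists (fun a => if a == i + n%:Z then x else c a) => /=.
have e : code (fun a => if a == i + n%:Z then x else c a) i n = code c i n.
  by apply: eq_code => j hj; case: eqP => // /addrI [] ?; lia.
by rewrite eqxx hx e hc -divn_eq.
Qed.

Lemma word_index_window (S : finType) r (c : int -> S) i :
  word_index (window r c i) = code c i r.
Proof.
rewrite /word_index.
have -> : tval (window r c i) = [seq c (i + j%:Z) | j <- iota 0 r].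
  by rewrite -val_enum_ord -map_comp.
elim: r => // r IH; have -> : iota 0 r.+1 = iota 0 r ++ [:: r] by rewrite -addn1 iotaD.
by rewrite map_cat foldl_cat IH.
Qed.

Lemma tuple_window (S : finType) r (q : S) (w : r.-tuple S) :
  w = window r (fun i => nth q w (absz i)) 0.
Proof. by apply: eq_from_tnth => j; rewrite tnth_mktuple (tnth_nth q) add0r. Qed.

Lemma word_index_inj (S : finType) r (q : S) : injective (@word_index S r).
Proof.
move=> w w'; rewrite (tuple_window q w) (tuple_window q w').
rewrite !word_index_window => /code_inj h; apply: eq_from_tnth => j.
by rewrite !tnth_mktuple h.
Qed.

Definition table (S : finType) (A : lqca S) (a : nat) : CC := cm (init_state A) a.

(** Addresses are injective in word and letter, so the double sum in [init_state] selects a single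
    term. *)
Lemma tableE (S : finType) (A : lqca S) w x :
  table A (word_index w * #|S| + srank x) = lq_delta A w x.
Proof.
rewrite /table /= (bigD1 w) //= (bigD1 x) //= /table_index eqxx.
rewrite big1 => [|y /negbTE hy]; last first.
  by case: eqP => // -[] /addnI /srank_inj e; rewrite e eqxx in hy.
rewrite big1 ?addr0 // => v /negbTE hv; rewrite big1 // => y _.
case: eqP => // -[] /(pair_code_inj (srank_lt _) (srank_lt _)) [/(word_index_inj (lq_q A)) e _].
by rewrite e eqxx in hv.
Qed.

Lemma overlapn_table (S : finType) (A : lqca S) w w' :
  overlapn #|S| (table A) (word_index w) (word_index w') = @overlapw S A w w'.
Proof.
rewrite /overlapn (reindex (@enum_rank S)); last exact: onW_bij (enum_rank_bij S).
by apply: eq_bigr => x _; rewrite -/(srank x) !tableE.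
Qed.

Lemma overlapn_code (S : finType) (A : lqca S) c c' i i' :
  overlapn #|S| (table A) (code c i (lq_r A)) (code c' i' (lq_r A)) =
  overlapw (window (lq_r A) c i) (window (lq_r A) c' i').
Proof. by rewrite -!word_index_window overlapn_table. Qed.

Lemma overlapw_diag (S : finType) (A : lqca S) (w : (lq_r A).-tuple S) :
  is_lqca A -> overlapw w w <> 0.
Proof.
case=> _ [/(_ w) h _] e; move: h; rewrite (eq_bigr _ (fun x _ => normCK _)).
by rewrite -/(overlapw w w) e ltxx.
Qed.

Lemma eq_window (S : finType) r (c c' : int -> S) i :
  (forall j, (j < r)%N -> c (i + j%:Z) = c' (i + j%:Z)) ->
  window r c i = window r c' i.
Proof. by move=> h; apply: eq_from_tnth => j; rewrite !tnth_mktuple h. Qed.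

Definition cut (S : finType) (q : S) (c : int -> S) (b : int) (a : int) : S :=
  if a < b then c a else q.

Definition put (S : finType) (c : int -> S) (b : int) (x : S) (a : int) : S :=
  if a == b then x else c a.

Lemma configs_cut (S : finType) (A : lqca S) c b : configs A c ->
  configs A (cut (lq_q A) c b).
Proof.
move=> /configs_bounded [n hn]; apply: (@bounded_configs _ _ _ n) => i /hn e.
by rewrite /cut e; case: ifP.
Qed.

Lemma configs_put (S : finType) (A : lqca S) c b x : configs A c -> configs A (put c b x).
Proof.
move=> /configs_bounded [n hn]; apply: (@bounded_configs _ _ _ (n + absz b).+1) => i h.
rewrite /put; case: eqP => [e|_]; first by rewrite e in h; lia.
by apply: hn; lia.
Qed.

(** * Collisions and orthogonality *)

Section Collision.
Variables (S : finType) (A : lqca S).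
Hypotheses (hA : is_lqca A) (hs : simple_lqca A).
Let q := lq_q A.
Let r := lq_r A.
Let k := #|S|.
Let M := (k ^ r.-1)%N.

Let r0 : (0 < r)%N. Proof. by case: hs. Qed.

Let codeS (c : int -> S) i :
  code c i r = (code c i r.-1 * k + srank (c (i + r.-1%:Z)%R))%N.
Proof. by rewrite -[in LHS](prednK r0). Qed.

Let codeM (c : int -> S) i : (code c i r %% M)%N = code c (i + 1)%R r.-1.
Proof. by rewrite -[in LHS](prednK r0) code_modn. Qed.

(** The overlap at [i] itself is left open until [ReachedChild] supplies it. Each step writes one
    letter per configuration at [i + r], a cell that no window starting at [i] or before
    contains. *)
Lemma reached_configs p : reached k M (table A) p -> exists c c' (i : int),
  [/\ configs A c /\ configs A c', p = (code c i r, code c' i r),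
      exists2 j, j < i + r%:Z & c j <> c' j &
      forall j, j < i -> overlapw (window r c j) (window r c' j) <> 0].
Proof.
elim => [u x y hu hx hy ne|p' x y _ [c [c' [i [[hc hc'] ep [j0 hj0 ne0] ho]]]] hov hM hx hy].
  have [c0 hc0] := code_surj q 0 hu.
  have [sx ex] := srank_surj hx; have [sy ey] := srank_surj hy.
  (* The common prefix fills the cells below [r - 1] and the differing letters go to cell [r - 1],
     so windows starting left of 0 are equal and overlap. *)
  pose c (a : int) := if (0 <= a) && (a < r.-1%:Z) then c0 a else q.
  have hc : configs A c.
    apply: (@bounded_configs _ _ _ r) => i hi; rewrite /c.
    by case: ifP => // /andP[h1 h2]; lia.
  have code_c s : code (put c r.-1%:Z s) 0 r = (u * k + srank s)%N.
    rewrite codeS /put add0r eqxx -hc0; congr (_ * _ + _)%N.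
    apply: eq_code => j hj; rewrite /c add0r; case: eqP => [[] e|_]; first by lia.
    by have -> : (0 <= j%:Z) && (j%:Z < r.-1%:Z) by lia.
  exists (put c r.-1%:Z sx), (put c r.-1%:Z sy), 0; split.
  - by split; exact: configs_put.
  - by rewrite !code_c ex ey.
  - exists r.-1%:Z; first by have := r0; lia.
    by rewrite /put eqxx => e; apply: ne; rewrite -ex -ey e.
  - move=> j hj; rewrite (eq_window (c' := put c r.-1%:Z sy)); first exact: overlapw_diag.
    by move=> a ha; rewrite /put; case: eqP => // e; have := r0; lia.
have [sx ex] := srank_surj hx; have [sy ey] := srank_surj hy.
rewrite ep /= in hov hM *.
have eb : i + 1 + r.-1%:Z = i + r%:Z by have := r0; lia.
have code_put (f : int -> S) s : code (put f (i + r%:Z) s) (i + 1) r = (code f i r %% M * k + srank s)%N.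
  rewrite codeS codeM eb /put eqxx; congr (_ * _ + _)%N; apply: eq_code => j hj.
  by case: eqP => // e; lia.
have window_put (f : int -> S) s j : j <= i -> window r (put f (i + r%:Z) s) j = window r f j.
  move=> hj; apply: eq_window => a ha; rewrite /put; case: eqP => // e; lia.
exists (put c (i + r%:Z) sx), (put c' (i + r%:Z) sy), (i + 1); split.
- by split; exact: configs_put.
- by rewrite !code_put ex ey.
- exists j0; first by lia.
  by rewrite /put; case: eqP => // e; lia.
- move=> j hj; have hji : j <= i by lia.
  rewrite !window_put //; case: (ltgtP j i) hji => // [/ho //|-> _].
  by rewrite overlapn_code in hov.
Qed.

Lemma collision_not_orthogonal : collision k M (table A) -> ~ columns_orthogonal A.
Proof.
move=> [p [/reached_configs [c [c' [i [[hc hc'] ep [j0 hj0 ne0] ho]]]] hov hM]] horth.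
rewrite ep /= overlapn_code in hov; rewrite ep /= !codeM in hM.
(* Cutting to [q] from [i + r] on keeps the window at [i] and the difference at [j0]; windows
   further right see only common letters and [q], hence agree. *)
pose d := cut q c (i + r%:Z); pose d' := cut q c' (i + r%:Z).
have hd : configs A d by exact: configs_cut.
have hd' : configs A d' by exact: configs_cut.
have ne : d <> d'.
  by move=> /(congr1 (@^~ j0)); rewrite /d /d' /cut hj0.
have := horth _ _ hd hd' ne; apply/(inner_neq0 hA hs hd hd') => j.
have window_cut (f : int -> S) a : a <= i -> window r (cut q f (i + r%:Z)) a = window r f a.
  by move=> ha; apply: eq_window => b hb; rewrite /cut; case: ifP => //; lia.
case: (ltgtP j i) => hj.
- by rewrite !window_cut ?ltW //; exact: ho.
- rewrite (eq_window (c' := d')); first exact: overlapw_diag.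
  move=> a ha; rewrite /d /d' /cut; case: ifP => // hlt.
  have e := code_inj hM; have := e (absz (j + a%:Z - (i + 1))%R).
  have -> : i + 1 + (absz (j + a%:Z - (i + 1))%R)%:Z = j + a%:Z by lia.
  by apply; have := r0; lia.
- by rewrite hj !window_cut.
Qed.

Lemma first_difference (c c' : int -> S) : configs A c -> configs A c' -> c <> c' ->
  exists j : int, c j <> c' j /\ forall a, a < j -> c a = c' a.
Proof.
move=> /configs_bounded [b hb] /configs_bounded [b' hb'] ne.
have out (a : int) : (b + b' <= absz a)%N -> c a = c' a.
  by move=> h; rewrite hb ?hb' //; lia.
have [j hj] : exists j, c j <> c' j.
  by apply: contrapT => h; apply: ne; apply/funext => j; apply: contrapT => e; apply: h; exists j.
(* All differences lie within [b + b'] of 0; the shift turns their positions into natural numbers,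
   so that a least one exists. *)
pose P n := c (n%:Z - (b + b')%N%:Z) != c' (n%:Z - (b + b')%N%:Z).
have exP : exists n, P n.
  have hlt : (absz j < b + b')%N by rewrite ltnNge; apply/negP => /out.
  exists (absz (j + (b + b')%N%:Z)%R); rewrite /P.
  have -> : (absz (j + (b + b')%N%:Z)%R)%:Z - (b + b')%N%:Z = j by lia.
  exact/eqP.
have [n /eqP Pn hmin] := ex_minnP exP.
exists (n%:Z - (b + b')%N%:Z); split=> // a ha.
case: (ltnP (absz a) (b + b')) => h; last exact: out.
apply/eqP; apply: contraT => hne; have := hmin (absz (a + (b + b')%N%:Z)%R).
rewrite /P; have -> : (absz (a + (b + b')%N%:Z)%R)%:Z - (b + b')%N%:Z = a by lia.
by move=> /(_ hne); lia.
Qed.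

Lemma not_orthogonal_collision : ~ columns_orthogonal A -> collision k M (table A).
Proof.
move=> hno; apply: contrapT => hcol; apply: hno => c c' hc hc' ne.
apply: contrapT => /(inner_neq0 hA hs hc hc') hov; apply: hcol.
have [j [hj hmin]] := first_difference hc hc' ne.
have [b hb] := configs_bounded hc; have [b' hb'] := configs_bounded hc'.
apply: contrapT => hcol.
(* The walk starts at the window whose last letter is the first difference. Without a collision the
   residues keep differing, so it never stops. *)
have hreach t : reached k M (table A)
    (code c (j - r.-1%:Z + t%:Z) r, code c' (j - r.-1%:Z + t%:Z) r).
  elim: t => [|t IH].
    rewrite !codeS addr0 subrK.
    rewrite (eq_code (c := c') (c' := c)); last by move=> a ha; rewrite hmin //; lia.
    apply: ReachedSeed; [exact: code_lt|exact: srank_lt|exact: srank_lt|].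
    by move/srank_inj.
  have hov' := hov (j - r.-1%:Z + t%:Z); rewrite -overlapn_code in hov'.
  have hM : (code c (j - r.-1%:Z + t%:Z) r %% M <> code c' (j - r.-1%:Z + t%:Z) r %% M)%N.
    by move=> hM; apply: hcol; eexists; split; [exact: IH|exact: hov'|exact: hM].
  have := ReachedChild IH hov' hM (srank_lt (c (j - r.-1%:Z + t.+1%:Z + r.-1%:Z)))
    (srank_lt (c' (j - r.-1%:Z + t.+1%:Z + r.-1%:Z))).
  have e : j - r.-1%:Z + t%:Z + 1 = j - r.-1%:Z + t.+1%:Z by lia.
  by rewrite /= !codeM e -!codeS.
(* After so many steps both suffixes lie beyond the supports and consist of [q] alone, so the pair
   is final after all. *)
pose t := (absz j + r + b + b')%N.
apply: hcol; eexists; split; [exact: (hreach t)|by rewrite /= overlapn_code; exact: hov|].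
rewrite /= !codeM; apply: eq_code => a ha.
by rewrite hb ?hb' // /t; lia.
Qed.

Lemma orthogonal_collision : columns_orthogonal A <-> ~ collision k M (table A).
Proof.
split=> [h /collision_not_orthogonal //|h].
by apply: contrapT => /not_orthogonal_collision.
Qed.

Lemma initialized_init_state :
  initialized k r (table A) (Store (updn (zr (init_state A)) 5 1)
    (zm (init_state A)) (cm (init_state A))).
Proof.
split=> //= a.
by have -> : -1 - a%:Z = Negz a by lia.
Qed.

End Collision.

Theorem theorem5 :
  exists (P : seq instr) (K : nat),
    forall (S : finType) (A : lqca S),
      is_lqca A -> simple_lqca A ->
      exists s' : mstate,
        run P (K * (#|S| ^ (lq_r A).+1) ^ 2)%N (init_state A) = Some s' /\
        (zr s' 0 = 1 <-> columns_orthogonal A).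
Proof.
exists (compile 0 decide), 156 => S A hA hs.
have k0 : (0 < #|S|)%N by apply/card_gt0P; exists (lq_q A).
have [r0 _] := hs.
have [s' [hrun hres]] := decide_correct k0 r0 (initialized_init_state hs).
exists s'; split; first exact: hrun.
by rewrite hres; split=> h; apply/(orthogonal_collision hA hs).
Qed.
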